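(* Let $f$ be a transcendental entire function and let $R_1>0$ be such that the sequence $(R_n)$ defined by $R_{n+1}=M(R_n)$, $n\in\mathbb N$, tends to $\infty$. Suppose that there exist $L>1$ and a sequence $(a_n)_{n\in\mathbb N}$ of positive real numbers such that, for all $n\in\mathbb N$ and all $r\in[R_n,R_{n+1})$, there exists $t\in(r,r^L)$ with \[ \frac{\log m(t)}{\log M(r)}\ \ge\ L(1-a_n), \] and such that $\sum_{n\in\mathbb N}a_n<\infty$. Then $F(f)$ has no unbounded components.
   Context: For a transcendental entire function $f$ and $r>0$, $M(r)=\max_{|z|=r}|f(z)|$ and $m(r)=\min_{|z|=r}|f(z)|$. $f^n$ denotes the $n$th iterate of $f$. The Fatou set $F(f)$ is the set of points $z\in\mathbb C$ such that $(f^n)_{n\in\mathbb N}$ forms a normal family in some neighbourhood of $z$. ''Components'' of $F(f)$ are its connected components. $\mathbb N=\{1,2,\dots\}$; $\log 0=-\infty$. *)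

(* Defs.v *)
From HB Require Import structures.
From mathcomp Require Import all_boot all_order all_algebra.
From mathcomp Require Export complex.
From mathcomp Require Import all_classical all_reals all_analysis.

Set Implicit Arguments.
Unset Strict Implicit.
Unset Printing Implicit Defensive.

Import Order.TTheory GRing.Theory Num.Theory.
Import numFieldNormedType.Exports.

Local Open Scope classical_set_scope.
Local Open Scope ring_scope.
Local Open Scope complex_scope.

(* The complex plane: [R[i]] seen as a normed space over itself, so that
   [derivable], [open], [compact], ... refer to the topology of the modulus and
   to complex scalars. *)
Notation Cplx R := (R[i]^o).

(* The modulus as an element of [R]; the norm [`|z|] of [R[i]] is valued in
   [R[i]]. *)
Notation cmod z := (Normc.normc z).

(* [derivable f z 1] is the existence of the limit of (f (z + h) - f z) / h
   as the complex number h tends to 0. *)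
Definition entire (R : realType) (f : Cplx R -> Cplx R) : Prop :=
  forall z : Cplx R, derivable f z 1.

Definition transcendental_entire (R : realType) (f : Cplx R -> Cplx R) : Prop :=
  entire f /\ ~ exists p : {poly R[i]}, forall z, f z = p.[z].

(* For continuous f and r >= 0 the circle is compact and nonempty, so the
   supremum and the infimum below are attained. *)
Definition max_modulus (R : realType) (f : Cplx R -> Cplx R) (r : R) : R :=
  sup [set cmod (f z) | z in [set z : Cplx R | cmod z = r]].

Definition min_modulus (R : realType) (f : Cplx R -> Cplx R) (r : R) : R :=
  inf [set cmod (f z) | z in [set z : Cplx R | cmod z = r]].

Definition sphere (R : realType) : Type := one_point_compactification (Cplx R).

Definition chordal (R : realType) (x y : sphere R) : R :=
  match x, y with
  | Some z, Some w =>
      2 * cmod (z - w) /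
        (Num.sqrt (1 + cmod z ^+ 2) * Num.sqrt (1 + cmod w ^+ 2))
  | Some z, None | None, Some z => 2 / Num.sqrt (1 + cmod z ^+ 2)
  | None, None => 0
  end.

(* Uniform convergence on compact subsets, for the chordal metric; this is
   locally uniform convergence when U is open. The limit is allowed to be
   infinite, so sequences tending to infinity do converge. *)
Definition locally_uniform_cvg (R : realType) (U : set (Cplx R))
    (g : nat -> Cplx R -> Cplx R) (h : Cplx R -> sphere R) : Prop :=
  forall K : set (Cplx R), compact K -> K `<=` U ->
  forall eps : R, 0 < eps ->
  \forall k \near \oo, forall z, K z -> chordal (Some (g k z)) (h z) < eps.

Definition normal_family (R : realType) (U : set (Cplx R))
    (F : set (Cplx R -> Cplx R)) : Prop :=
  forall g : nat -> Cplx R -> Cplx R, (forall n, F (g n)) ->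
  exists phi : nat -> nat, {homo phi : m n / (m < n)%N} /\
  exists h : Cplx R -> sphere R, locally_uniform_cvg U (g \o phi) h.

Definition iterates (R : realType) (f : Cplx R -> Cplx R) :
    set (Cplx R -> Cplx R) :=
  [set iter n f | n in [set n | (0 < n)%N]].

Definition Fatou (R : realType) (f : Cplx R -> Cplx R) : set (Cplx R) :=
  [set z | exists2 U, open_nbhs z U & normal_family U (iterates f)].

(* Main.v *)
Require Import Defs.
From HB Require Import structures.
From mathcomp Require Import all_boot all_order all_algebra.
From mathcomp Require Import complex.
From mathcomp Require Import all_classical all_reals all_analysis.
From mathcomp Require Import ring lra.

Set Implicit Arguments.
Unset Strict Implicit.
Unset Printing Implicit Defensive.

Import Order.TTheory GRing.Theory Num.Theory.
Import numFieldNormedType.Exports.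

Local Open Scope classical_set_scope.
Local Open Scope ring_scope.

(** Suppose that a component U of the Fatou set is unbounded; the theorem is
    proved by studying log |f^n| on U.

    First, the iterates are comparable on U. Near a Fatou point an iterate is
    either bounded by a fixed constant or of modulus greater than 1
    ([Fatou_dichotomy]). In the second case log |f^n| is positive and harmonic,
    and Harnack's inequality applies ([harnack_log_modulus]). Passing through
    overlapping discs, log |f^n(y)| and log |f^n(y')| have a bounded ratio for
    all y, y' in U ([connected_by_local_property]).

    Next, the hypothesis on the minimum modulus makes connected sets stretch. If
    a connected set K joins |z| <= R_N to |z| >= R_N^(2L), then its image under
    f^k reaches |w| >= R_(N+k)^L for all k ([orbit_growth]); since a point z with
    |z| <= R_N satisfies |f^k(z)| <= R_(N+k), the logarithms of the modulus on K
    differ by a factor of at least L > 1 for every k. Such sets K exist in U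
    because U is unbounded, so log |f^k(y)| is comparable with log R_(N+k), for
    every y in U.

    This leads to a contradiction by two alternatives. Let D be a small disc in
    U with centre x.

    - If for some large p the image of D under f^p contains the circle through
      f^p(x) about 0, then U, which is connected and unbounded, meets that
      circle; so there are d and u = f^p(d), both in U. Hence log |f^(n+p)(d)|
      = log |f^n(u)| is at most a constant times log |f^n(d)|, and log R_(n+p) is
      at most a constant times log R_n. This is impossible as R_(n+1) = M(R_n) and f is
      transcendental.

    - Otherwise f^p omits on D a point of the circle, for every large p. Then a
      logarithm of f^p avoids a point that is very close to its value at x,
      compared with its size, and a second use of Harnack's inequality shows that
      log |f^p| is constant on a smaller disc up to a factor tending to 1
      ([log_modulus_of_circle_omitting]). Passing through overlapping discs again,
      the ratio of log |f^p| at any two points of a connected set K as above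
      tends to 1 uniformly, which contradicts the factor L.

    The function theory is developed from complex differentiability. Goursat's
    theorem in exponential coordinates gives the mean value property on circles,
    valid even if the function is only continuous at the centre ([cavg_hol]).
    It yields the maximum principle ([max_principle]), the gradient estimate that
    integrates to Harnack's inequality ([gradient]), the fact that an entire
    function of polynomial growth is a polynomial ([poly_of_growth]) and the
    convexity property M(r^c) >= M(r)^c for large r ([max_modulus_powR]). *)

(** * Modulus, discs and segments in the plane *)

Section Plane.
Local Open Scope complex_scope.
Variable R : realType.
Local Notation C := (Cplx R).
Local Notation Re := (@complex.Re R).
Local Notation Im := (@complex.Im R).
Implicit Types (z w : C) (r e : R).

Lemma cmodE z : `|z| = (cmod z)%:C.
Proof. by case: z. Qed.

Lemma cmod_ge0 z : 0 <= cmod z.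
Proof. by case: z => a b; exact: sqrtr_ge0. Qed.

Lemma cmodD z w : cmod (z + w) <= cmod z + cmod w.
Proof. exact: le_normcD. Qed.

Lemma cmodN z : cmod (- z) = cmod z.
Proof. exact: normcN. Qed.

Lemma cmodM z w : cmod (z * w) = cmod z * cmod w.
Proof. exact: Normc.normcM. Qed.

Lemma cmodV z : cmod (z^-1) = (cmod z)^-1.
Proof. exact: Normc.normcV. Qed.

Lemma cmod0 : cmod (0 : C) = 0.
Proof. exact: Normc.normc0. Qed.

Lemma cmod1 : cmod (1 : C) = 1.
Proof. exact: Normc.normc1. Qed.

Lemma cmodX z n : cmod (z ^+ n) = cmod z ^+ n.
Proof. by elim: n => [|n IH]; rewrite ?cmod1// !exprS cmodM IH. Qed.

Lemma cmod_eq0 z : (cmod z == 0) = (z == 0).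
Proof.
by apply/eqP/eqP => [/Normc.eq0_normc//|->]; rewrite cmod0.
Qed.

Lemma cmod_gt0 z : (0 < cmod z) = (z != 0).
Proof. by rewrite lt_neqAle cmod_ge0 andbT eq_sym cmod_eq0. Qed.

Lemma cmodB z w : cmod (z - w) = cmod (w - z).
Proof. by rewrite -cmodN opprB. Qed.

Lemma cmod_real r : cmod (r%:C : C) = `|r|.
Proof. by rewrite /= expr0n/= addr0 sqrtr_sqr. Qed.

Lemma Re_le_cmod z : `|Re z| <= cmod z.
Proof. by case: z => a b /=; rewrite -sqrtr_sqr ler_wsqrtr// lerDl sqr_ge0. Qed.

Lemma Im_le_cmod z : `|Im z| <= cmod z.
Proof. by case: z => a b /=; rewrite -sqrtr_sqr ler_wsqrtr// lerDr sqr_ge0. Qed.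

Lemma cmod_le_ReIm z : cmod z <= `|Re z| + `|Im z|.
Proof.
case: z => a b /=; rewrite -[leRHS]ger0_norm ?addr_ge0// -sqrtr_sqr.
rewrite ler_wsqrtr// sqrrD !real_normK ?num_real//.
by have := mulr_ge0 (normr_ge0 a) (normr_ge0 b); lra.
Qed.

Lemma ler_cmodB z w : `|cmod z - cmod w| <= cmod (z - w).
Proof.
rewrite ler_norml; apply/andP; split.
  by rewrite lerNl opprB lerBlDr cmodB; apply: le_trans (cmodD _ _); rewrite subrK.
by rewrite lerBlDr; apply: le_trans (cmodD _ _); rewrite subrK.
Qed.

(** The topology of the plane is that of a normed space over itself, with norms
    and radii in [R[i]]. All later arguments use real radii and the real
    modulus, and this lemma is the bridge. *)
Lemma nbhs_cdisc z (A : set C) :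
  nbhs z A <-> exists2 e : R, 0 < e & forall w, cmod (w - z) < e -> A w.
Proof.
split.
- move=> /nbhs_ballP[[e1 e2] /= ]; rewrite ltcE/= => /andP[/eqP -> e10] H.
  exists e1 => // w wz; apply: H; rewrite /ball/= cmodE.
  by rewrite ltcE/= eqxx/= cmodB.
- move=> [e e0 H]; apply/nbhs_ballP; exists e%:C; first by rewrite /= ltcR.
  by move=> w; rewrite /ball/= cmodE ltcR cmodB; exact: H.
Qed.


Lemma cont_cdiscP (g : C -> C) z :
  {for z, continuous g} <->
  forall e : R, 0 < e -> exists2 d : R, 0 < d &
    forall w, cmod (w - z) < d -> cmod (g w - g z) < e.
Proof.
split=> H.
- move=> e e0.
  have : nbhs (g z) [set y : C | cmod (y - g z) < e] by apply/nbhs_cdisc; exists e.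
  by move/H => /nbhs_cdisc[d d0 Hd]; exists d.
- move=> A /nbhs_cdisc[e e0 He]; apply/nbhs_cdisc.
  have [d d0 Hd] := H e e0; exists d => // w wz; apply: He; exact: Hd.
Qed.

Lemma rcont_cdiscP (g : C -> R) z :
  {for z, continuous g} <->
  forall e : R, 0 < e -> exists2 d : R, 0 < d &
    forall w, cmod (w - z) < d -> `|g w - g z| < e.
Proof.
split=> H.
- move=> e e0.
  have : nbhs (g z) [set y : R | `|y - g z| < e].
    by apply/nbhs_ballP; exists e => // y; rewrite /ball/= distrC.
  by move/H => /nbhs_cdisc[d d0 Hd]; exists d.
- move=> A /nbhs_ballP[e e0 He]; apply/nbhs_cdisc.
  have [d d0 Hd] := H e e0; exists d => // w wz; apply: He.
  by rewrite /ball/= distrC; exact: Hd.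
Qed.

Lemma Re_cont (z : C) : {for z, continuous (Re : C -> R)}.
Proof.
apply/rcont_cdiscP => e e0; exists e => // w; apply: le_lt_trans.
by case: w z => [a b] [c d]; exact: (Re_le_cmod (_ +i* _ - _ +i* _)).
Qed.

Lemma Im_cont (z : C) : {for z, continuous (Im : C -> R)}.
Proof.
apply/rcont_cdiscP => e e0; exists e => // w; apply: le_lt_trans.
by case: w z => [a b] [c d]; exact: (Im_le_cmod (_ +i* _ - _ +i* _)).
Qed.

Lemma cmodB_cont (a z : C) : {for z, continuous (fun w : C => cmod (w - a))}.
Proof.
apply/rcont_cdiscP => e e0; exists e => // w; apply: le_lt_trans.
by apply: le_trans (ler_cmodB _ _) _; rewrite opprB addrA subrK.
Qed.

Lemma cmod_cont (z : C) : {for z, continuous (fun w : C => cmod w)}.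
Proof.
by apply/rcont_cdiscP => e e0; exists e => // w; apply: le_lt_trans; exact: ler_cmodB.
Qed.

Lemma closed_sublevel (F : C -> R) r : continuous F -> closed [set w : C | F w <= r].
Proof. by move=> cF; apply: (@preimage_closed _ _ F [set x | x <= r]) => //; exact: closed_le. Qed.

Lemma closed_superlevel (F : C -> R) r : continuous F -> closed [set w : C | r <= F w].
Proof. by move=> cF; apply: (@preimage_closed _ _ F [set x | r <= x]) => //; exact: closed_ge. Qed.

(** A closed disc is a closed part of the image of a square. *)
Lemma closed_disc_compact (z : C) r : compact [set w : C | cmod (w - z) <= r].
Proof.
have [r0|r0] := ltP r 0.
  rewrite (_ : [set _ | _] = set0); first exact: compact0.
  rewrite -subset0 => w /=; apply/negP; rewrite -ltNge.
  by apply: lt_le_trans r0 _; exact: cmod_ge0.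
pose I := `[- r, r]%classic.
have cI : compact I by exact: segment_compact.
pose q (p : R * R) : C := z + (p.1 +i* p.2).
have cq : continuous q.
  move=> p A /nbhs_cdisc[e e0 He].
  have : nbhs p [set p' : R * R | `|p.1 - p'.1| < e / 2 /\ `|p.2 - p'.2| < e / 2].
    by apply/nbhs_ballP; exists (e / 2); rewrite /= ?divr_gt0// => y [].
  apply: filterS => p' [h1 h2]; apply: He; apply: le_lt_trans (cmod_le_ReIm _) _.
  rewrite /q opprD addrACA subrr add0r /=.
  by rewrite [ltRHS](splitr e) ltrD// -normrN opprB.
have cK : compact (q @` (I `*` I)).
  by apply: continuous_compact (compact_setX cI cI); exact: continuous_subspaceT.
apply: (subclosed_compact _ cK).
- by apply: closed_sublevel => w; exact: cmodB_cont.
- move=> w /= wz; exists (Re (w - z), Im (w - z)).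
    split; rewrite /I /= in_itv /= -ler_norml; apply: le_trans wz.
      exact: Re_le_cmod.
    exact: Im_le_cmod.
  by rewrite /q /= [X in z + X](_ : _ = w - z) ?[z + _]addrC ?subrK//; case: (w - z).
Qed.


Lemma EVT_max_plane (K : set C) (F : C -> R) (p : C) :
  K p -> compact K -> (forall z, K z -> {for z, continuous F}) ->
  exists2 c, K c & forall z, K z -> F z <= F c.
Proof.
move=> Kp cK cF; have [|//||c cK' H] := @compact_EVT_max _ R F K.
- by exists p.
- apply: continuous_in_subspaceT => z; rewrite inE; exact: cF.
- by exists c; [rewrite inE in cK'|move=> z Kz; apply: H; rewrite inE].
Qed.

Lemma connected_IVT (K : set C) (F : C -> R) (p q : C) (t : R) :
  connected K -> (forall z, K z -> {for z, continuous F}) ->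
  K p -> K q -> F p <= t <= F q -> exists2 z, K z & F z = t.
Proof.
move=> cK cF Kp Kq ht.
have : connected (F @` K).
  apply: connected_continuous_connected => //.
  by apply: continuous_in_subspaceT => z; rewrite inE; exact: cF.
move=> /connected_intervalP/(_ (F p) (F q)) H.
have [||z Kz <-] := H _ _ t ht; [by exists p|by exists q|by exists z].
Qed.

(** Segments serve both to join points inside discs and as the curves along
    which derivatives are integrated. *)
Definition seg (a b : C) (t : R) : C := a + t%:C * (b - a).

Lemma seg0 a b : seg a b 0 = a. Proof. by rewrite /seg mul0r addr0. Qed.

Lemma seg1 a b : seg a b 1 = b. Proof. by rewrite /seg mul1r addrC subrK. Qed.

Lemma cmod_segB a b t s : cmod (seg a b t - seg a b s) = `|t - s| * cmod (b - a).
Proof. by rewrite /seg opprD addrACA subrr add0r -mulrBl -rmorphB cmodM cmod_real. Qed.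

Lemma seg_cont a b : continuous (seg a b).
Proof.
move=> t A /nbhs_cdisc[e e0 He]; apply/nbhs_ballP.
exists (e / (cmod (b - a) + 1)) => /=.
  by rewrite divr_gt0// ltr_wpDl// cmod_ge0.
move=> s; rewrite /ball/= distrC => hs; apply: He; rewrite cmod_segB.
have [->|n0] := eqVneq (cmod (b - a)) 0; first by rewrite mulr0.
have c0 : 0 < cmod (b - a) by rewrite lt_neqAle eq_sym n0 cmod_ge0.
rewrite (lt_trans (_ : _ < e / (cmod (b - a) + 1) * cmod (b - a)))//.
  by rewrite ltr_pM2r.
by rewrite -mulrA gtr_pMr// mulrC ltr_pdivrMr ?mul1r ?ltrDl// ltr_wpDl// cmod_ge0.
Qed.

Lemma seg_connected a b : connected (seg a b @` `[0, 1]%classic).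
Proof.
apply: connected_continuous_connected; first exact: segment_connected.
by apply: continuous_subspaceT; exact: seg_cont.
Qed.

Lemma disc_connected (z : C) r : connected [set w : C | cmod (w - z) < r].
Proof.
have [r0|r0] := leP r 0.
  rewrite (_ : [set _ | _] = set0); first exact: connected0.
  rewrite -subset0 => w /=; apply/negP; rewrite -leNgt.
  by apply: le_trans r0 _; exact: cmod_ge0.
rewrite (_ : [set _ | _] = \bigcup_(w in [set w : C | cmod (w - z) < r]) (seg z w @` `[0, 1]%classic)).
  apply: bigcup_connected; last by move=> w _; exact: seg_connected.
  by exists z => w _; exists 0; rewrite ?seg0//= in_itv /= lexx ler01.
rewrite eqEsubset; split => [w /= wr|w [w' /= w'r [t]]].
  by exists w => //; exists 1; rewrite ?seg1//= in_itv /= lexx ler01.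
rewrite /= in_itv /= => /andP[t0 t1 <-].
rewrite -{2}(seg0 z w') cmod_segB subr0 ger0_norm//.
by apply: le_lt_trans w'r; rewrite ler_piMl// cmod_ge0.
Qed.

End Plane.

(** * Complex differentiability, exponential and logarithm *)

Section Hol.
Local Open Scope complex_scope.
Variable R : realType.
Local Notation C := (Cplx R).
Local Notation Re := (@complex.Re R).
Local Notation Im := (@complex.Im R).
Implicit Types (z w : C) (r e : R) (g k : C -> C).

(** Complex differentiability at a point, as an inductive type so that it is not
    unfolded to a statement about filters. *)
Variant hol g z : Prop := Hol of derivable g z 1.

(** The first-order expansion of [g] at [z] with derivative [l]; unlike [hol] it
    keeps the value of the derivative at hand. *)
Definition cdiff g z (l : C) := forall e, 0 < e -> exists2 d, 0 < d &
  forall w, cmod (w - z) < d -> cmod (g w - g z - l * (w - z)) <= e * cmod (w - z).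

Lemma holP g z : hol g z <-> exists l, cdiff g z l.
Proof.
split.
- move=> [/cvg_ex[/= l gl]]; exists l => e e0.
  have : nbhs l [set y : C | cmod (y - l) < e] by apply/nbhs_cdisc; exists e.
  move=> /gl; rewrite /nbhs/= /dnbhs/= /within/=.
  move=> /nbhs_cdisc[d d0 H]; exists d => // w wz.
  have [->|wnz] := eqVneq w z; first by rewrite !subrr mulr0 subr0 cmod0 mulr0.
  have nz : w - z != 0 by rewrite subr_eq0.
  have := H (w - z); rewrite subr0 => /(_ wz nz).
  rewrite [_ *: 1]mulr1 subrK => h.
  rewrite (_ : _ - _ = ((w - z)^-1 *: (g w - g z) - l) * (w - z)).
    by rewrite cmodM ler_wpM2r ?cmod_ge0// ltW.
  by rewrite mulrBl [_ *: _]mulrC mulfVK.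
- move=> [l H]; split; apply/cvg_ex; exists l => A /nbhs_cdisc[e e0 He].
  rewrite /nbhs/= /dnbhs/= /within/=; apply/nbhs_cdisc.
  have [d d0 Hd] := H (e / 2) (divr_gt0 e0 (ltr0Sn _ 1)).
  exists d => // h; rewrite subr0 => hd hn; apply: He.
  have := Hd (h + z); rewrite addrK => /(_ hd).
  rewrite [_ *: 1]mulr1 => h1.
  rewrite (_ : _ - l = h^-1 * (g (h + z) - g z - l * h)); last first.
    by rewrite mulrBr mulrCA mulVf// mulr1.
  rewrite cmodM cmodV mulrC ltr_pdivrMr ?cmod_gt0//.
  apply: le_lt_trans h1 _; rewrite ltr_pM2r ?cmod_gt0//.
  by rewrite gtr_pMr// invf_lt1// ltr1n.
Qed.

Lemma hol_diff g z : hol g z <-> differentiable g z.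
Proof.
split=> [[/derivable1_diffP//]|h].
by split; apply/derivable1_diffP.
Qed.

Lemma hol_cont g z : hol g z -> {for z, continuous g}.
Proof. by move=> /hol_diff; exact: differentiable_continuous. Qed.

Lemma hol_local g k z r : 0 < r -> (forall w, cmod (w - z) < r -> k w = g w) ->
  hol g z -> hol k z.
Proof.
move=> r0 kg /holP[l gl]; apply/holP; exists l => e /gl[d d0 H].
exists (Num.min d r); first by rewrite lt_min d0.
move=> w; rewrite lt_min => /andP[wd wr].
by rewrite !kg ?subrr ?cmod0//; exact: H.
Qed.

Lemma hol_cst (a : C) z : hol (fun=> a) z.
Proof. by split; exact: derivable_cst. Qed.

Lemma hol_id z : hol id z.
Proof. by split; exact: derivable_id. Qed.

Lemma holD g k z : hol g z -> hol k z -> hol (fun w => g w + k w) z.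
Proof. by move=> [hg] [hk]; split; exact: (@derivableD _ _ _ g k z 1 hg hk). Qed.

Lemma holB g k z : hol g z -> hol k z -> hol (fun w => g w - k w) z.
Proof. by move=> [hg] [hk]; split; exact: (@derivableB _ _ _ g k z 1 hg hk). Qed.

Lemma holM g k z : hol g z -> hol k z -> hol (fun w => g w * k w) z.
Proof. by move=> [hg] [hk]; split; exact: (@derivableM _ _ g k z 1 hg hk). Qed.

Lemma holX g n z : hol g z -> hol (fun w => g w ^+ n) z.
Proof.
move=> gz; elim: n => [|n IH]; first exact: hol_cst.
have -> : (fun w => g w ^+ n.+1) = (fun w => g w * g w ^+ n).
  by apply/funext => w; rewrite exprS.
exact: holM.
Qed.

Lemma holV g z : g z != 0 -> hol g z -> hol (fun w => (g w)^-1) z.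
Proof. by move=> g0 [hg]; split; exact: (@derivableV _ _ g z 1 g0 hg). Qed.

Lemma hol_comp g k z : hol g z -> hol k (g z) -> hol (k \o g) z.
Proof. by move=> /hol_diff gz /hol_diff kz; apply/hol_diff; exact: (@differentiable_comp _ C C C g k z gz kz). Qed.

Lemma hol_sum (I : Type) (s : seq I) (g : I -> C -> C) z :
  (forall i, hol (g i) z) -> hol (fun w => \sum_(i <- s) g i w) z.
Proof.
move=> gz; elim: s => [|i s IH].
  have -> : (fun w => \sum_(i <- [::]) g i w) = (fun=> 0).
    by apply/funext => w; rewrite big_nil.
  exact: hol_cst.
have -> : (fun w => \sum_(j <- i :: s) g j w) = (fun w => g i w + \sum_(j <- s) g j w).
  by apply/funext => w; rewrite big_cons.
exact: (@holD (g i) (fun w => \sum_(j <- s) g j w) z (gz i) IH).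
Qed.

Lemma cont_mul g k z : {for z, continuous g} -> {for z, continuous k} ->
  {for z, continuous (fun w => g w * k w)}.
Proof. by move=> gz kz; exact: (@continuousM C C g k z gz kz). Qed.

Lemma cont_sub g k z : {for z, continuous g} -> {for z, continuous k} ->
  {for z, continuous (fun w => g w - k w)}.
Proof. by move=> gz kz; exact: (@continuousB C C C g k z gz kz). Qed.

Lemma cont_inv g z : g z != 0 -> {for z, continuous g} ->
  {for z, continuous (fun w => (g w)^-1)}.
Proof. by move=> gz kz; exact: (@continuousV C C g z gz kz). Qed.

Definition cexp z : C := (expR (Re z))%:C * (cos (Im z) +i* sin (Im z)).

Lemma cexpD z w : cexp (z + w) = cexp z * cexp w.
Proof.
case: z w => [a b] [c d]; rewrite /cexp /= expRD cosD sinD.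
by simpc; congr (_ +i* _); ring.
Qed.

Lemma cexp0 : cexp 0 = 1.
Proof. by rewrite /cexp /= expR0 cos0 sin0; simpc. Qed.

Lemma cmod_cexp z : cmod (cexp z) = expR (Re z).
Proof.
rewrite /cexp cmodM cmod_real gtr0_norm ?expR_gt0//=.
by rewrite cos2Dsin2 sqrtr1 mulr1.
Qed.

Lemma cexp_neq0 z : cexp z != 0.
Proof. by rewrite -cmod_gt0 cmod_cexp expR_gt0. Qed.

Lemma real_expansion (f : R -> R) (x l : R) : is_derive x 1 f l ->
  forall e, 0 < e -> exists2 d, 0 < d & forall y, `|y - x| < d ->
    `|f y - f x - l * (y - x)| <= e * `|y - x|.
Proof.
move=> [fx fl] e e0.
have : (h^-1 *: (f (h *: 1 + x) - f x)) @[h --> 0^'] --> l.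
  by rewrite -fl; exact: fx.
move=> /cvgrPdist_le/(_ e e0); rewrite /prop_near1 /nbhs/= /dnbhs/= /within/=.
move=> /nbhs_ballP[d d0 H]; exists d => // y hy.
have [->|ynx] := eqVneq y x; first by rewrite !subrr mulr0 subr0 normr0 mulr0.
have nz : y - x != 0 by rewrite subr_eq0.
have := H (y - x); rewrite /ball/= sub0r normrN => /(_ hy nz).
rewrite [_ *: 1]mulr1 subrK => h.
rewrite (_ : _ - _ = ((y - x)^-1 * (f y - f x) - l) * (y - x)).
  by rewrite normrM ler_wpM2r// distrC.
by rewrite mulrBl mulrAC mulVf// mul1r.
Qed.

End Hol.

Section Exp.
Local Open Scope complex_scope.
Variable R : realType.
Local Notation C := (Cplx R).
Local Notation Re := (@complex.Re R).
Local Notation Im := (@complex.Im R).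
Implicit Types (z w : C) (r e : R) (g k : C -> C).

Lemma cReD z w : Re (z + w) = Re z + Re w. Proof. by case: z w => [a b] [c d]. Qed.
Lemma cImD z w : Im (z + w) = Im z + Im w. Proof. by case: z w => [a b] [c d]. Qed.
Lemma cReN z : Re (- z) = - Re z. Proof. by case: z. Qed.
Lemma cImN z : Im (- z) = - Im z. Proof. by case: z. Qed.
Lemma cReM z w : Re (z * w) = Re z * Re w - Im z * Im w.
Proof. by case: z w => [a b] [c d]. Qed.
Lemma cImM z w : Im (z * w) = Re z * Im w + Im z * Re w.
Proof. by case: z w => [a b] [c d]. Qed.

Lemma cplx_eq z w : Re z = Re w -> Im z = Im w -> z = w.
Proof. by case: z w => [a b] [c d] /= -> ->. Qed.

(** With h = a + ib and u = cos b + i sin b,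
    exp h - 1 - h = (exp a - 1 - a) u + (1 + a) (u - 1 - ib) + iab,
    and each summand is small by the real expansions of exp, cos and sin. *)
Lemma cexp_expansion0 : cdiff (@cexp R) 0 1.
Proof.
move=> e e0.
have [e1 e10 [e1l1 e1le]] : exists2 e1 : R, 0 < e1 & e1 <= 1 /\ 6 * e1 <= e.
  exists (Num.min 1 (e / 6)); first by rewrite lt_min ltr01 divr_gt0.
  by split; [rewrite ge_min lexx|rewrite mulrC -ler_pdivlMr// ge_min lexx orbT].
have [d1 d10 H1] := real_expansion (is_derive_expR (0 : R)) e10.
have [d2 d20 H2] := real_expansion (is_derive_cos (0 : R)) e10.
have [d3 d30 H3] := real_expansion (is_derive_sin (0 : R)) e10.
exists (Num.min (Num.min d1 d2) (Num.min d3 e1)); first by rewrite !lt_min d10 d20 d30 e10.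
move=> h; rewrite !subr0 !lt_min => /andP[/andP[hd1 hd2] /andP[hd3 he1]].
have ha := Re_le_cmod h; have hb := Im_le_cmod h.
have := H1 (Re h); have := H2 (Im h); have := H3 (Im h).
rewrite !subr0 => /(_ (le_lt_trans hb hd3)) h3 /(_ (le_lt_trans hb hd2)) h2
  /(_ (le_lt_trans ha hd1)) h1 {H1 H2 H3}.
rewrite expR0 mul1r cos0 sin0 ?subr0 ?oppr0 ?mul0r ?mul1r ?subr0 in h1 h2 h3 *.
rewrite cexp0.
set a := Re h in ha h1 *; set b := Im h in hb h2 h3 *.
set x := expR a - 1 - a in h1 *; set y := cos b - 1 in h2 *; set t := sin b - b in h3 *.
have -> : cexp h - 1 - h = x%:C * (cos b +i* sin b) + (1 + a)%:C * (y +i* t) + (0 +i* (a * b)).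
  rewrite /cexp -/a -/b; apply: cplx_eq.
    by rewrite !(cReD, cReN, cReM) /= -/a /x /y; ring.
  by rewrite !(cImD, cImN, cImM) /= -/b /x /t; ring.
have n1 : cmod ((cos b +i* sin b) : C) = 1 by rewrite /= cos2Dsin2 sqrtr1.
have n2 : cmod ((y +i* t) : C) <= 2 * e1 * cmod h.
  apply: le_trans (cmod_le_ReIm _) _ => /=.
  have : e1 * `|b| <= e1 * cmod h by rewrite ler_wpM2l// ltW.
  lra.
have n3 : cmod ((0 +i* (a * b)) : C) <= e1 * cmod h.
  apply: le_trans (cmod_le_ReIm _) _ => /=; rewrite normr0 add0r normrM ler_pM//.
  exact: le_trans ha (ltW he1).
have n4 : `|1 + a| <= 2.
  apply: le_trans (ler_normD _ _) _; rewrite normr1.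
  have := le_trans ha (le_trans (ltW he1) e1l1); lra.
have n5 : `|x| <= e1 * cmod h by apply: le_trans h1 _; rewrite ler_wpM2l// ltW.
apply: le_trans (cmodD _ _) _.
apply: le_trans (lerD (cmodD _ _) (lexx _)) _.
rewrite !cmodM !cmod_real n1 mulr1.
have n6 : `|1 + a| * cmod (y +i* t) <= 2 * (2 * e1 * cmod h).
  by rewrite ler_pM// cmod_ge0.
have : 6 * e1 * cmod h <= e * cmod h by rewrite ler_wpM2r// cmod_ge0.
lra.
Qed.

Lemma cexp_expansion z : cdiff (@cexp R) z (cexp z).
Proof.
move=> e e0.
have z0 : 0 < cmod (cexp z) by rewrite cmod_gt0 cexp_neq0.
have [d d0 H] := cexp_expansion0 (divr_gt0 e0 z0).
exists d => // w wz; have := H (w - z); rewrite subr0 => /(_ wz).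
rewrite cexp0 mul1r => h.
have -> : cexp w - cexp z - cexp z * (w - z) = cexp z * (cexp (w - z) - 1 - (w - z)).
  have {1}-> : cexp w = cexp z * cexp (w - z) by rewrite -cexpD addrC subrK.
  by ring.
rewrite cmodM.
have -> : e * cmod (w - z) = cmod (cexp z) * (e / cmod (cexp z) * cmod (w - z)).
  by rewrite mulrA mulrCA mulfV ?gt_eqF// mulr1.
by rewrite ler_pM2l.
Qed.

Lemma hol_cexp z : hol (@cexp R) z.
Proof. by apply/holP; exists (cexp z); exact: cexp_expansion. Qed.

Lemma polar z : cmod z = 1 -> exists2 b : R, `|b| <= pi & z = cexp (0 +i* b).
Proof.
case: z => x y /(congr1 (fun t => t ^+ 2)) /=.
rewrite sqr_sqrtr ?addr_ge0 ?sqr_ge0// expr1n => xy.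
have x1 : -1 <= x <= 1.
  rewrite -ler_norml -(@ler_pXn2r _ 2) ?nnegrE//.
  by rewrite real_normK ?num_real// expr1n -xy lerDl sqr_ge0.
have sq : Num.sqrt (1 - x ^+ 2) = `|y| by rewrite -xy addrC addKr sqrtr_sqr.
have p0 := acos_ge0 x1; have pp := acos_lepi x1.
have ck : cos (acos x) = x by apply: acosK; rewrite in_itv.
have [y0|y0] := leP 0 y.
  exists (acos x); first by rewrite ger0_norm.
  rewrite /cexp /= expR0 mul1r ck sin_acos// sq ger0_norm//.
exists (- acos x); first by rewrite normrN ger0_norm.
by rewrite /cexp /= expR0 mul1r cosN sinN ck sin_acos// sq ltr0_norm// opprK.
Qed.

(** Multiply exp z by a unimodular exp (ib) with |b| <= pi. *)
Lemma cexp_onto_circle z w : cmod w = cmod (cexp z) ->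
  exists2 o : C, cexp o = w & cmod (o - z) <= pi.
Proof.
move=> h; have n0 : cmod (cexp z) != 0 by rewrite cmod_eq0 cexp_neq0.
have [|b bp Hb] := @polar (w / cexp z).
  by rewrite cmodM cmodV h mulfV.
exists (z + (0 +i* b)).
  by rewrite cexpD -Hb mulrC divfK// cexp_neq0.
rewrite addrC addKr; apply: le_trans (cmod_le_ReIm _) _.
by rewrite /= normr0 add0r.
Qed.

Definition Log z : C := ln (cmod z) +i* atan (Im z / Re z).

Lemma cexp_Log z : 0 < Re z -> cexp (Log z) = z.
Proof.
case: z => x y /= x0.
have m0 : 0 < cmod (x +i* y) by apply: lt_le_trans (Re_le_cmod _); rewrite /= gtr0_norm.
rewrite /Log /cexp /=.
have sE : cmod (x +i* y) = x * Num.sqrt (1 + (y / x) ^+ 2).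
  rewrite /= -{2}[x]gtr0_norm// -sqrtr_sqr -sqrtrM ?sqr_ge0//; congr Num.sqrt.
  by field; rewrite gt_eqF.
have c0 : cos (atan (y / x)) != 0.
  rewrite cos_atan invr_eq0 gt_eqF// sqrtr_gt0.
  by have := sqr_ge0 (y / x); lra.
have sA : sin (atan (y / x)) = y / x * cos (atan (y / x)).
  by rewrite -{2}(atanK (y / x)) /tan divfK.
rewrite /= in sE.
rewrite lnK ?posrE // sA cos_atan sE.
set q := Num.sqrt (1 + _).
have q0 : q != 0.
  by move: c0; rewrite cos_atan invr_eq0.
apply: cplx_eq; rewrite /=; field; rewrite ?q0 ?gt_eqF//.
Qed.
End Exp.

Section LogS.
Local Open Scope complex_scope.
Variable R : realType.
Local Notation C := (Cplx R).
Local Notation Re := (@complex.Re R).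
Local Notation Im := (@complex.Im R).
Implicit Types (z w : C) (r e : R) (g k : C -> C).

Lemma cont_pair (F G : C -> R) z : {for z, continuous F} -> {for z, continuous G} ->
  {for z, continuous (fun w : C => (F w +i* G w : C))}.
Proof.
move=> /rcont_cdiscP cF /rcont_cdiscP cG; apply/cont_cdiscP => e e0.
have e20 : 0 < e / 2 by rewrite divr_gt0.
have [d1 d10 H1] := cF _ e20; have [d2 d20 H2] := cG _ e20.
exists (Num.min d1 d2); first by rewrite lt_min d10.
move=> w; rewrite lt_min => /andP[/H1 h1 /H2 h2].
by apply: le_lt_trans (cmod_le_ReIm _) _ => /=; rewrite [ltRHS](splitr e) ltrD.
Qed.

Lemma Log_cont z : 0 < Re z -> {for z, continuous (@Log R)}.
Proof.
move=> z0; apply: cont_pair.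
  apply: (@continuous_comp _ _ _ (fun w : C => cmod w) (@ln R)); first exact: cmod_cont.
  apply: continuous_ln; rewrite cmod_gt0; apply: contraTneq z0 => ->.
  by rewrite ltxx.
apply: (@continuous_comp _ _ _ (fun w : C => Im w / Re w) (@atan R)); last exact: continuous_atan.
apply: (@continuousM R C Im (fun w => (Re w)^-1) z); first exact: Im_cont.
by apply: (@continuousV R C Re z); [rewrite gt_eqF|exact: Re_cont].
Qed.

(** The logarithm is a continuous right inverse of the exponential, whose
    derivative does not vanish; so it is differentiable. *)
Lemma hol_Log z : 0 < Re z -> hol (@Log R) z.
Proof.
move=> z0; apply/holP; exists z^-1 => e e0.
have nz : z != 0 by apply: contraTneq z0 => ->; rewrite ltxx.
have mz : 0 < cmod z by rewrite cmod_gt0.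
have [e1 e10 [e1l e1e]] : exists2 e1 : R, 0 < e1 & e1 <= 2^-1 /\ 2 * e1 <= e * cmod z.
  exists (Num.min 2^-1 (e * cmod z / 2)).
    by rewrite lt_min invr_gt0 ltr0n divr_gt0// mulr_gt0.
  by split; [rewrite ge_min lexx|rewrite mulrC -ler_pdivlMr// ge_min lexx orbT].
have [d1 d10 H1] := cexp_expansion0 e10.
have /cont_cdiscP/(_ _ d10)[d2 d20 H2] := Log_cont z0.
exists (Num.min d2 (Re z)); first by rewrite lt_min d20.
move=> w; rewrite lt_min => /andP[wd wz].
have w0 : 0 < Re w.
  have : `|Re (w - z)| <= cmod (w - z) by exact: Re_le_cmod.
  rewrite cReD cReN ler_norml => /andP[h _]; lra.
have := H1 (Log w - Log z); rewrite subr0 => /(_ (H2 _ wd)).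
rewrite cexp0 mul1r; set L := Log w - Log z => h.
have eL : w = z * cexp L.
  by rewrite -[X in X * _](cexp_Log z0) -cexpD /L addrC subrK cexp_Log.
have e2 : cmod (w - z - z * L) <= cmod z * (e1 * cmod L).
  have -> : w - z - z * L = z * (cexp L - 1 - L) by rewrite eL; ring.
  by rewrite cmodM ler_pM2l.
have e3 : cmod z * cmod L <= 2 * cmod (w - z).
  have : cmod (z * L) <= cmod (w - z) + cmod (w - z - z * L).
    rewrite -[z * L](subKr (w - z)).
    by apply: le_trans (cmodD _ _) _; rewrite cmodN subKr.
  rewrite cmodM.
  have : cmod z * (e1 * cmod L) <= cmod z * (2^-1 * cmod L).
    by rewrite ler_pM2l// ler_wpM2r// cmod_ge0.
  lra.
have -> : L - z^-1 * (w - z) = - (z^-1 * (w - z - z * L)) by field.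
rewrite cmodN cmodM cmodV ler_pdivrMl//; apply: le_trans e2 _.
have h1 : e1 * (cmod z * cmod L) <= e1 * (2 * cmod (w - z)) by rewrite ler_pM2l.
have h2 : 2 * e1 * cmod (w - z) <= e * cmod z * cmod (w - z).
  by rewrite ler_wpM2r// cmod_ge0.
lra.
Qed.
End LogS.

(** * Goursat's theorem *)

Section Goursat.
Local Open Scope complex_scope.
Variable R : realType.
Implicit Types (a b c d s t : R) (f g : R -> R).

Local Notation mu := (@lebesgue_measure R).

Definition rintegral a b f : R := \int[mu]_(x in `[a, b]) f x.

Lemma rintegral_integrable a b f : {within `[a, b], continuous f} ->
  mu.-integrable `[a, b] (EFin \o f).
Proof. by move=> cf; apply: continuous_compact_integrable => //; exact: segment_compact. Qed.

Lemma rintegral_split a m b f : a <= m <= b -> {within `[a, b], continuous f} ->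
  rintegral a b f = rintegral a m f + rintegral m b f.
Proof.
move=> /andP[am mb] cf; have fi := rintegral_integrable cf.
have := @Rintegral_itvB R f (BLeft a) (BRight b) m fi; rewrite !bnd_simp => /(_ am mb) h.
rewrite -[LHS](subrK (rintegral a m f)) /rintegral h addrC; congr (_ + _).
rewrite Rintegral_itv_obnd_cbnd//; apply: integrableS fi => //.
by apply: subset_itvr; rewrite bnd_simp.
Qed.

Lemma rintegralD a b f g : {within `[a, b], continuous f} -> {within `[a, b], continuous g} ->
  rintegral a b (fun x => f x + g x) = rintegral a b f + rintegral a b g.
Proof. by move=> cf cg; rewrite /rintegral RintegralD//; exact: rintegral_integrable. Qed.

Lemma rintegralB a b f g : {within `[a, b], continuous f} -> {within `[a, b], continuous g} ->
  rintegral a b (fun x => f x - g x) = rintegral a b f - rintegral a b g.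
Proof. by move=> cf cg; rewrite /rintegral RintegralB//; exact: rintegral_integrable. Qed.

Lemma eq_rintegral a b f g : (forall x, a <= x <= b -> f x = g x) -> rintegral a b f = rintegral a b g.
Proof. by move=> fg; apply: eq_Rintegral => x; rewrite inE /= in_itv; exact: fg. Qed.

Lemma rintegral_cst a b k : a <= b -> rintegral a b (fun=> k) = k * (b - a).
Proof.
move=> ab; rewrite /rintegral Rintegral_cst//; congr (_ * _).
have h : lebesgue_measure `[a, b]%classic = (b - a)%:E.
  rewrite (lebesgue_measure_itv `[a, b]) /= lte_fin; case: ltP => //= ba.
  by have -> : b - a = 0 by lra.
exact: (congr1 fine h).
Qed.

Lemma le_rintegral a b f g : {within `[a, b], continuous f} -> {within `[a, b], continuous g} ->
  (forall x, a <= x <= b -> f x <= g x) -> rintegral a b f <= rintegral a b g.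
Proof.
move=> cf cg fg; by apply: le_Rintegral => //; exact: rintegral_integrable.
Qed.

Lemma rintegral_near_cst a b f k e : a <= b -> {within `[a, b], continuous f} ->
  (forall x, a <= x <= b -> `|f x - k| <= e) -> `|rintegral a b f - k * (b - a)| <= e * (b - a).
Proof.
move=> ab cf H.
have cc (y : R) : {within `[a, b], continuous (fun=> y : R)}.
  by apply: continuous_subspaceT => ?; exact: cvg_cst.
have h1 : rintegral a b (fun=> k - e) <= rintegral a b f.
  by apply: le_rintegral => // x /H; rewrite ler_norml => /andP[h _]; lra.
have h2 : rintegral a b f <= rintegral a b (fun=> k + e).
  by apply: le_rintegral => // x /H; rewrite ler_norml => /andP[_ h]; lra.
move: h1 h2; rewrite !rintegral_cst// ler_norml => h1 h2; apply/andP; split; lra.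
Qed.

(** The lower left corners of the nested rectangles increase, the upper right ones
    decrease, and the sides tend to 0. *)
Lemma bisection (Bad : R -> R -> R -> R -> Prop) a0 b0 c0 d0 :
  a0 <= b0 -> c0 <= d0 -> Bad a0 b0 c0 d0 ->
  (forall a b c d, a0 <= a -> a <= b -> b <= b0 -> c0 <= c -> c <= d -> d <= d0 ->
     Bad a b c d -> exists a' b' c' d',
       [/\ a <= a' <= b' /\ b' <= b, b' - a' = (b - a) / 2,
           c <= c' <= d' /\ d' <= d, d' - c' = (d - c) / 2 & Bad a' b' c' d']) ->
  exists s t, [/\ a0 <= s <= b0, c0 <= t <= d0 &
    forall e, 0 < e -> exists a b c d,
      [/\ a0 <= a /\ b <= b0, c0 <= c /\ d <= d0, a <= s <= b /\ b - a < e,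
          c <= t <= d /\ d - c < e & Bad a b c d]].
Proof.
move=> ab0 cd0 B0 step.
pose good (x : R * R * R * R) := let: (a, b, c, d) := x in
  [/\ a0 <= a, a <= b, b <= b0 & [/\ c0 <= c, c <= d, d <= d0 & Bad a b c d]].
pose nxt (x y : R * R * R * R) := let: (a, b, c, d) := x in let: (a', b', c', d') := y in
  [/\ a <= a' <= b' /\ b' <= b, b' - a' = (b - a) / 2,
           c <= c' <= d' /\ d' <= d & d' - c' = (d - c) / 2].
have : forall x, exists y, good x -> good y /\ nxt x y.
  move=> [[[a b] c] d]; have [|ng] := pselect (good (a, b, c, d)); last by exists (a, b, c, d).
  move=> [h1 h2 h3 [h4 h5 h6 h7]].
  have [a' [b' [c' [d' [[/andP[k1 k1'] k2] k3 [/andP[k4 k4'] k5] k6 k7]]]]] :=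
    step _ _ _ _ h1 h2 h3 h4 h5 h6 h7.
  exists (a', b', c', d') => _; rewrite /good /nxt k1 k1' k4 k4'.
  by split; split => //; [exact: le_trans k1|exact: le_trans h3|split => //; [exact: le_trans k4|exact: le_trans h6]].
move=> /choice[F HF].
pose x n := iter n F (a0, b0, c0, d0).
pose A n := (x n).1.1.1; pose B n := (x n).1.1.2; pose Cc n := (x n).1.2; pose D n := (x n).2.
have gx n : good (x n).
  by elim: n => [|n /HF[]]; [split|].
have nx n : nxt (x n) (x n.+1) by have [] := HF _ (gx n).
have gA n : [/\ a0 <= A n, A n <= B n, B n <= b0 & [/\ c0 <= Cc n, Cc n <= D n, D n <= d0 & Bad (A n) (B n) (Cc n) (D n)]].
  by have := gx n; rewrite /A /B /Cc /D /good; case: (x n) => [[[]]].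
have nA n : [/\ A n <= A n.+1 <= B n.+1 /\ B n.+1 <= B n, B n.+1 - A n.+1 = (B n - A n) / 2,
           Cc n <= Cc n.+1 <= D n.+1 /\ D n.+1 <= D n & D n.+1 - Cc n.+1 = (D n - Cc n) / 2].
  by have := nx n; rewrite /A /B /Cc /D /nxt; case: (x n) => [[[? ?] ?] ?]; case: (x n.+1) => [[[]]].
have nest (U V : nat -> R) : (forall n, U n <= U n.+1) -> (forall n, V n.+1 <= V n) ->
    (forall n, U n <= V n) -> exists s, forall n, U n <= s <= V n.
  move=> Uu Vd UV.
  have Um m n : (m <= n)%N -> U m <= U n.
    by move=> /subnKC <-; elim: (n - m)%N => [|k IH]; rewrite ?addn0// addnS (le_trans IH).
  have Vm m n : (m <= n)%N -> V n <= V m.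
    by move=> /subnKC <-; elim: (n - m)%N => [|k IH]; rewrite ?addn0// addnS (le_trans _ IH).
  have UVm m n : U m <= V n.
    apply: le_trans (Um _ _ (leq_maxl m n)) _.
    by apply: le_trans (UV _) _; apply: Vm; exact: leq_maxr.
  exists (sup (range U)) => n; apply/andP; split.
    apply: ub_le_sup; last by exists n.
    by exists (V 0%N) => _ [m _ <-].
  by apply: ge_sup; [exists (U 0%N), 0%N|move=> _ [m _ <-]].
have lenz (W : nat -> R) : (forall n, W n.+1 = W n / 2) -> forall e, 0 < e ->
    exists N, forall n, (N <= n)%N -> W n < e.
  move=> WH e e0; have WE n : W n = W 0%N / 2 ^+ n.
    by elim: n => [|n IH]; rewrite ?expr0 ?divr1// WH IH exprSr invfM mulrA.
  exists (Num.bound (`|W 0%N| / e)) => n hn.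
  rewrite WE ltr_pdivrMr ?exprn_gt0// -ltr_pdivrMl// mulrC.
  apply: (@le_lt_trans _ _ (`|W 0%N| / e)); first by rewrite ler_pM2r ?invr_gt0// ler_norm.
  apply: lt_trans (archi_boundP _) _; first by rewrite divr_ge0// ltW.
  by rewrite -natrX ltr_nat (leq_ltn_trans hn)// ltn_expl.
have [s Hs] : exists s, forall n, A n <= s <= B n.
  by apply: nest => n; [case: (nA n) => [[/andP[]]]|case: (nA n) => [[/andP[]]]|case: (gA n)].
have [t Ht] : exists t, forall n, Cc n <= t <= D n.
  apply: nest => n; [by case: (nA n) => _ _ [/andP[]]|by case: (nA n) => _ _ [/andP[]]|].
  by case: (gA n) => _ _ _ [].
exists s, t; split; [exact: (Hs 0%N)|exact: (Ht 0%N)|].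
move=> e e0.
have [N1 H1] : exists N, forall n, (N <= n)%N -> B n - A n < e.
  by apply: lenz e0 => n; case: (nA n).
have [N2 H2] : exists N, forall n, (N <= n)%N -> D n - Cc n < e.
  by apply: lenz e0 => n; case: (nA n).
pose n := maxn N1 N2.
exists (A n), (B n), (Cc n), (D n).
have [g1 g2 g3 [g4 g5 g6 g7]] := gA n.
by rewrite Hs Ht H1 ?leq_maxl// H2 ?leq_maxr//.
Qed.

End Goursat.

Section Goursat2.
Local Open Scope complex_scope.
Variable R : realType.
Implicit Types (a b c d s t : R).

Lemma dist_le_length a b s t : a <= s <= b -> a <= t <= b -> `|s - t| <= b - a.
Proof.
by move=> /andP[? ?] /andP[? ?]; rewrite ler_norml; apply/andP; split; lra.
Qed.

Lemma halving a b : a <= b -> [/\ a <= (a + b) / 2, (a + b) / 2 <= b,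
  (a + b) / 2 - a = (b - a) / 2 & b - (a + b) / 2 = (b - a) / 2].
Proof. by move=> ab; split; lra. Qed.

(** Goursat's theorem for the closed 1-form v ds + u dt, which is the imaginary
    part of G(w) dw for G = u + iv and w = s + it. The boundary integral is
    additive under subdivision. A rectangle whose integral exceeds a fixed
    multiple of the square of its half-perimeter has a quarter with the same
    property, so such rectangles shrink to a point; but there u and v differ
    from affine functions, whose contribution cancels, by an error that is small
    compared with the diameter. *)
Lemma goursat (u v : R -> R -> R) a0 b0 c0 d0 :
  a0 <= b0 -> c0 <= d0 ->
  (forall s, a0 <= s <= b0 -> {within `[c0, d0], continuous (u s)}) ->
  (forall t, c0 <= t <= d0 -> {within `[a0, b0], continuous (v^~ t)}) ->
  (forall s t, a0 <= s <= b0 -> c0 <= t <= d0 -> exists k l : R,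
     forall e, 0 < e -> exists2 dl, 0 < dl & forall s' t',
       a0 <= s' <= b0 -> c0 <= t' <= d0 -> `|s' - s| < dl -> `|t' - t| < dl ->
       `|u s' t' - u s t - (k * (s' - s) - l * (t' - t))| <= e * (`|s' - s| + `|t' - t|) /\
       `|v s' t' - v s t - (l * (s' - s) + k * (t' - t))| <= e * (`|s' - s| + `|t' - t|)) ->
  rintegral c0 d0 (fun t => u b0 t - u a0 t) + rintegral a0 b0 (fun s => v s c0 - v s d0) = 0.
Proof.
move=> ab0 cd0 cu cv duv.
pose M a b c d := rintegral c d (fun t => u b t - u a t) + rintegral a b (fun s => v s c - v s d).
have sub (x y p q : R) (f : R -> R) : x <= p -> q <= y ->
    {within `[x, y], continuous f} -> {within `[p, q], continuous f}.
  move=> xp qy; apply: continuous_subspaceW => z /=; rewrite !in_itv /= => /andP[h1 h2].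
  by rewrite (le_trans xp h1) (le_trans h2 qy).
have cB (x y : R) (f g : R -> R) : {within `[x, y], continuous f} ->
    {within `[x, y], continuous g} -> {within `[x, y], continuous (fun z => f z - g z)}.
  by move=> cf cg z; apply: continuousB; [exact: cf|exact: cg].
rewrite -/(M a0 b0 c0 d0); apply/eqP/negPn/negP => M0.
pose W0 := (b0 - a0) + (d0 - c0).
have M00 : 0 < `|M a0 b0 c0 d0| by rewrite normr_gt0.
have W00 : 0 < W0 ^+ 2 + 1 by have := sqr_ge0 W0; lra.
(* a constant for which the whole rectangle is bad; adding 1 covers the case
   in which it is a point *)
pose kp := `|M a0 b0 c0 d0| / (2 * (W0 ^+ 2 + 1)).
have kp0 : 0 < kp by rewrite divr_gt0// mulr_gt0.
pose Bad a b c d : Prop := kp * ((b - a) + (d - c)) ^+ 2 < `|M a b c d|.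
have B0 : Bad a0 b0 c0 d0.
  rewrite /Bad -/W0 /kp mulrAC ltr_pdivrMr ?mulr_gt0// ltr_pM2l//.
  have := sqr_ge0 W0; lra.
have [|s [t [hs ht H]]] := @bisection R Bad a0 b0 c0 d0 ab0 cd0 B0.
  move=> a b c d h1 h2 h3 h4 h5 h6 B.
  pose m := (a + b) / 2; pose n := (c + d) / 2.
  have [am mb e1 e2] := halving h2; rewrite -/m in am mb e1 e2.
  have [cn nd e3 e4] := halving h5; rewrite -/n in cn nd e3 e4.
  have aI : a0 <= a <= b0 by rewrite h1 (le_trans h2).
  have bI : a0 <= b <= b0 by rewrite h3 (le_trans h1).
  have cI : c0 <= c <= d0 by rewrite h4 (le_trans h5).
  have dI : c0 <= d <= d0 by rewrite h6 (le_trans h4).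
  have mI : a0 <= m <= b0 by rewrite (le_trans h1 am) (le_trans mb h3).
  have nI : c0 <= n <= d0 by rewrite (le_trans h4 cn) (le_trans nd h6).
  have cu' x : a0 <= x <= b0 -> {within `[c, d], continuous (u x)}.
    by move=> /cu; exact: sub.
  have cv' x : c0 <= x <= d0 -> {within `[a, b], continuous (v^~ x)}.
    by move=> /cv; exact: sub.
  have split1 : M a b c d = M a m c d + M m b c d.
    rewrite /M (rintegral_split (m := m) (a := a)) ?am//; last by apply: cB; exact: cv'.
    have -> : rintegral c d (fun t => u b t - u a t) =
        rintegral c d (fun t => (u m t - u a t) + (u b t - u m t)).
      by apply: eq_rintegral => x _; ring.
    rewrite rintegralD; [|by apply: cB; exact: cu'..].
    by rewrite addrACA.
  have split2 x y : a <= x -> y <= b -> a0 <= x <= b0 -> a0 <= y <= b0 ->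
      M x y c d = M x y c n + M x y n d.
    move=> ax yb xI yI.
    have cv'' z : c0 <= z <= d0 -> {within `[x, y], continuous (v^~ z)}.
      by move=> /cv'; exact: sub.
    rewrite /M (rintegral_split (m := n) (a := c)) ?cn//; last by apply: cB; exact: cu'.
    have -> : rintegral x y (fun s => v s c - v s d) =
        rintegral x y (fun s => (v s c - v s n) + (v s n - v s d)).
      by apply: eq_rintegral => z _; ring.
    rewrite (rintegralD (a := x) (b := y)); [|exact: (cB x y (v^~ c) (v^~ n) (cv'' _ cI) (cv'' _ nI))|exact: (cB x y (v^~ n) (v^~ d) (cv'' _ nI) (cv'' _ dI))].
    by rewrite addrACA.
  pose W := (b - a) + (d - c).
  have quarter p q r z : (q - p) = (b - a) / 2 -> z - r = (d - c) / 2 -> ~ Bad p q r z ->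
      `|M p q r z| <= kp * W ^+ 2 / 4.
    move=> e5 e6 /negP; rewrite /Bad -leNgt e5 e6 => h; apply: le_trans h _.
    by rewrite le_eqVlt; apply/orP; left; apply/eqP; rewrite /W; field.
  have [B1|/quarter q1] := pselect (Bad a m c n).
    by exists a, m, c, n; split => //; split; rewrite ?am ?cn ?lexx.
  have [B2|/quarter q2] := pselect (Bad a m n d).
    by exists a, m, n, d; split => //; split; rewrite ?am ?cn ?lexx.
  have [B3|/quarter q3] := pselect (Bad m b c n).
    by exists m, b, c, n; split => //; split; rewrite ?am ?cn ?lexx ?mb.
  have [B4|/quarter q4] := pselect (Bad m b n d).
    by exists m, b, n, d; split => //; split; rewrite ?am ?cn ?lexx ?mb.
  exfalso; move: B; rewrite /Bad -/W split1 (split2 a m) ?(split2 m b)//.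
  apply/negP; rewrite -leNgt.
  apply: le_trans (ler_normD _ _) (le_trans (lerD (ler_normD _ _) (ler_normD _ _)) _).
  apply: le_trans (lerD (lerD (q1 e1 e3) (q2 e1 e4)) (lerD (q3 e2 e3) (q4 e2 e4))) _.
  by rewrite le_eqVlt; apply/orP; left; apply/eqP; field.
have [k [l Hkl]] := duv s t hs ht.
have [dl dl0 E] := Hkl (kp / 2) (divr_gt0 kp0 (ltr0Sn _ 1)).
have [a [b [c [d [[h1 h2] [h3 h4] [sI ba] [tI dc] B]]]]] := H dl dl0.
have [/andP[as_ sb] /andP[ct td]] := (sI, tI).
have ab : a <= b := le_trans as_ sb.
have cd : c <= d := le_trans ct td.
have in1 x : a <= x <= b -> a0 <= x <= b0.
  by move=> /andP[x1 x2]; rewrite (le_trans h1 x1) (le_trans x2 h2).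
have in2 y : c <= y <= d -> c0 <= y <= d0.
  by move=> /andP[y1 y2]; rewrite (le_trans h3 y1) (le_trans y2 h4).
pose W := (b - a) + (d - c).
have near x y : a <= x <= b -> c <= y <= d ->
   `|u x y - u s t - (k * (x - s) - l * (y - t))| <= kp / 2 * W /\
   `|v x y - v s t - (l * (x - s) + k * (y - t))| <= kp / 2 * W.
  move=> xI yI.
  have n1 := dist_le_length xI sI; have n2 := dist_le_length yI tI.
  have le1 : kp / 2 * (`|x - s| + `|y - t|) <= kp / 2 * W.
    by apply: ler_wpM2l; [rewrite divr_ge0// ltW|exact: lerD].
  have [g1 g2] := E x y (in1 _ xI) (in2 _ yI) (le_lt_trans n1 ba) (le_lt_trans n2 dc).
  by split; [exact: le_trans le1|exact: le_trans le1].
have twice (p q : R) : `|p| <= kp / 2 * W -> `|q| <= kp / 2 * W -> `|p - q| <= kp * W.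
  move=> p1 q1; apply: le_trans (ler_normB _ _) (le_trans (lerD p1 q1) _).
  by rewrite -mulrDl -splitr.
have aI : a <= a <= b by rewrite lexx.
have bI : a <= b <= b by rewrite lexx andbT.
have cI : c <= c <= d by rewrite lexx.
have dI : c <= d <= d by rewrite lexx andbT.
have r1 : `|rintegral c d (fun t => u b t - u a t) - k * (b - a) * (d - c)| <= kp * W * (d - c).
  apply: rintegral_near_cst => //.
    by apply: cB; apply: (sub c0 d0) => //; apply: cu; exact: in1.
  move=> y yI; have [g1 _] := near b y bI yI; have [g2 _] := near a y aI yI.
  by apply: le_trans (twice _ _ g1 g2); rewrite le_eqVlt; apply/orP; left; apply/eqP;
    congr (`| _ |); ring.
have r2 : `|rintegral a b (fun s => v s c - v s d) - k * (c - d) * (b - a)| <= kp * W * (b - a).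
  apply: rintegral_near_cst => //.
    by apply: cB; apply: (sub a0 b0) => //; apply: cv; exact: in2.
  move=> x xI; have [_ g1] := near x c xI cI; have [_ g2] := near x d xI dI.
  by apply: le_trans (twice _ _ g1 g2); rewrite le_eqVlt; apply/orP; left; apply/eqP;
    congr (`| _ |); ring.
move: B; rewrite /Bad /M; apply/negP; rewrite -leNgt -/W.
have -> : rintegral c d (fun t => u b t - u a t) + rintegral a b (fun s => v s c - v s d) =
  rintegral c d (fun t => u b t - u a t) - k * (b - a) * (d - c) +
  (rintegral a b (fun s => v s c - v s d) - k * (c - d) * (b - a)) by ring.
apply: le_trans (ler_normD _ _) (le_trans (lerD r1 r2) _).
by rewrite -mulrDr [X in _ * X]addrC -/W expr2 mulrA.
Qed.

End Goursat2.

(** * Mean values over circles *)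

Section Mean.
Local Open Scope complex_scope.
Variable R : realType.
Local Notation C := (Cplx R).
Local Notation Re := (@complex.Re R).
Local Notation Im := (@complex.Im R).
Implicit Types (z w : C) (r e t : R) (g k : C -> C) (F G : C -> R).

Definition circ z r t : C := z + r%:C * cexp (0 +i* t).

Definition cavg F z r : R := rintegral 0 (pi *+ 2) (fun t => F (circ z r t)) / (pi *+ 2).

Lemma cmod_circ z r t : 0 <= r -> cmod (circ z r t - z) = r.
Proof.
move=> r0; rewrite /circ addrC addKr cmodM cmod_real ger0_norm// cmod_cexp.
by rewrite expR0 mulr1.
Qed.

Lemma circE z s t : z + cexp (s +i* t) = circ z (expR s) t.
Proof. by rewrite /circ /cexp /= expR0 mul1r. Qed.

Lemma vline_cont s t : {for t, continuous (fun t' : R => (s +i* t' : C))}.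
Proof.
move=> A /nbhs_cdisc[e e0 He]; apply/nbhs_ballP; exists e => // t'.
rewrite /ball/= distrC => h; apply: He; apply: le_lt_trans (cmod_le_ReIm _) _.
by rewrite /= subrr normr0 add0r.
Qed.

Lemma hline_cont s t : {for s, continuous (fun s' : R => (s' +i* t : C))}.
Proof.
move=> A /nbhs_cdisc[e e0 He]; apply/nbhs_ballP; exists e => // t'.
rewrite /ball/= distrC => h; apply: He; apply: le_lt_trans (cmod_le_ReIm _) _.
by rewrite /= subrr normr0 addr0.
Qed.

Lemma hol_zexp z w : hol (fun x => z + cexp x) w.
Proof. by apply: (@holD R (fun=> z) (@cexp R)); [exact: hol_cst|exact: hol_cexp]. Qed.

Lemma cont_circ z r t : {for t, continuous (circ z r)}.
Proof.
have h1 := @vline_cont 0 t.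
have h2 : {for (0 +i* t), continuous (fun x : C => z + r%:C * cexp x)}.
  apply: hol_cont; apply: (@holD R (fun=> z) (fun x => r%:C * cexp x)); first exact: hol_cst.
  by apply: (@holM R (fun=> r%:C) (@cexp R)); [exact: hol_cst|exact: hol_cexp].
exact: (@continuous_comp _ _ _ _ (fun x : C => z + r%:C * cexp x) t h1 h2).
Qed.

Lemma cont_on_circ F z r : (forall t, {for circ z r t, continuous F}) ->
  {within `[0, pi *+ 2], continuous (fun t => F (circ z r t))}.
Proof.
move=> cF; apply: continuous_subspaceT => t.
by apply: (@continuous_comp _ _ _ (circ z r) F t); [exact: cont_circ|exact: cF].
Qed.

Lemma pi2_gt0 : 0 < pi *+ 2 :> R.
Proof. by rewrite pmulrn_lgt0// pi_gt0. Qed.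

Lemma cavg_cst a z r : cavg (fun=> a) z r = a.
Proof. by rewrite /cavg rintegral_cst ?subr0 ?mulfK ?gt_eqF ?pi2_gt0// ltW// pi2_gt0. Qed.

Lemma le_cavg F G z r : 0 <= r -> (forall t, {for circ z r t, continuous F}) ->
  (forall t, {for circ z r t, continuous G}) ->
  (forall w, cmod (w - z) = r -> F w <= G w) -> cavg F z r <= cavg G z r.
Proof.
move=> r0 cF cG FG; rewrite /cavg ler_pM2r ?invr_gt0 ?pi2_gt0//.
by apply: le_rintegral => [||t _]; [exact: cont_on_circ..|apply: FG; rewrite cmod_circ].
Qed.

Lemma Re_hol_cont g w : hol g w -> {for w, continuous (fun x => Re (g x))}.
Proof.
by move=> /hol_cont cg; apply: (@continuous_comp _ _ _ g Re w); [exact: cg|exact: Re_cont].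
Qed.

Lemma Im_hol_cont g w : hol g w -> {for w, continuous (fun x => Im (g x))}.
Proof.
by move=> /hol_cont cg; apply: (@continuous_comp _ _ _ g Im w); [exact: cg|exact: Im_cont].
Qed.

(** In the coordinates w = z + exp (s + it) an annulus becomes a strip, and the
    two circles become the vertical sides of a rectangle of height 2 pi. Its
    horizontal sides contribute equally, by periodicity, so Goursat's theorem
    equates the integrals over the vertical sides. *)
Lemma cavg_indep g z rho r1 r2 : 0 < r1 -> r1 <= r2 -> r2 < rho ->
  (forall w, 0 < cmod (w - z) < rho -> hol g w) ->
  cavg (fun w => Re (g w)) z r1 = cavg (fun w => Re (g w)) z r2.
Proof.
move=> r10 r12 r2r hg.
have r20 : 0 < r2 by exact: lt_le_trans r12.
pose G x := g (z + cexp x).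
have hG s t : s <= ln r2 -> hol G (s +i* t).
  move=> sl; apply: (@hol_comp R (fun x => z + cexp x) g); first exact: hol_zexp.
  apply: hg; rewrite circE cmod_circ ?expR_ge0// expR_gt0/=.
  by apply: le_lt_trans r2r; rewrite -[leRHS]lnK ?posrE// ler_expR.
have l12 : ln r1 <= ln r2 by rewrite ler_ln ?posrE.
have := @goursat R (fun s t => Re (G (s +i* t))) (fun s t => Im (G (s +i* t)))
  (ln r1) (ln r2) 0 (pi *+ 2) l12 (ltW pi2_gt0).
have cu s : s <= ln r2 -> {within `[0, pi *+ 2], continuous (fun t => Re (G (s +i* t)))}.
  move=> sl; apply: continuous_subspaceT => t.
  apply: (@continuous_comp _ _ _ (fun t' : R => (s +i* t' : C)) (fun x => Re (G x)) t).
    exact: vline_cont.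
  by apply: Re_hol_cont; exact: hG.
have cexp_per s : (s +i* (pi *+ 2)) = (s +i* 0) + (0 +i* (pi *+ 2)) :> C.
  by apply: cplx_eq => /=; rewrite ?addr0 ?add0r.
have perG s : G (s +i* (pi *+ 2)) = G (s +i* 0).
  have e2 : cexp (0 +i* (pi *+ 2)) = 1 :> C by rewrite /cexp /= expR0 cos2pi sin2pi mulr1.
  by rewrite /G cexp_per cexpD e2 mulr1.
move=> GS; unshelve epose proof (GS _ _ _) as K; move: GS => _.
- by move=> s /andP[_ sl]; exact: cu.
- move=> t _; apply: continuous_in_subspaceT => s; rewrite inE /= in_itv /= => /andP[_ sl].
  apply: (@continuous_comp _ _ _ (fun s' : R => (s' +i* t : C)) (fun x => Im (G x)) s).
    exact: hline_cont.
  by apply: Im_hol_cont; exact: hG.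
- move=> s t /andP[s1 s2] _; have /holP[l Hl] := hG s t s2.
  exists (Re l), (Im l) => e e0; have [d d0 H] := Hl e e0.
  exists (d / 2); first by rewrite divr_gt0.
  move=> s' t' _ _ hs ht.
  have cle : cmod ((s' +i* t' : C) - (s +i* t)) <= `|s' - s| + `|t' - t|.
    exact: cmod_le_ReIm.
  have {}H := H (s' +i* t') (le_lt_trans cle _).
  have {H} : cmod (G (s' +i* t') - G (s +i* t) - l * ((s' +i* t' : C) - (s +i* t))) <=
      e * (`|s' - s| + `|t' - t|).
    apply: le_trans (H _) _; first by rewrite [ltRHS](splitr d) ltrD.
    by rewrite ler_wpM2l// ltW.
  move=> h; split; apply: le_trans h.
    apply: le_trans (Re_le_cmod _); rewrite !(cReD, cReN, cReM, cImD, cImN) /=.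
    rewrite le_eqVlt; apply/orP; left; apply/eqP; congr (`| _ |); ring.
  apply: le_trans (Im_le_cmod _); rewrite !(cReD, cReN, cImM, cImD, cImN) /=.
  rewrite le_eqVlt; apply/orP; left; apply/eqP; congr (`| _ |); ring.
move: K; rewrite rintegralB; [|exact: cu|exact: cu].
rewrite [X in _ + X](_ : _ = 0); last first.
  rewrite (@eq_rintegral _ _ _ _ (fun=> 0)); first by rewrite rintegral_cst ?mul0r.
  by move=> s _; rewrite perG subrr.
rewrite addr0 => /eqP; rewrite subr_eq0 => /eqP h.
rewrite /cavg; congr (_ / _).
rewrite (@eq_rintegral _ _ _ _ (fun t => Re (G (ln r1 +i* t)))); last first.
  by move=> t _; rewrite /G circE lnK ?posrE.
rewrite -h; apply: eq_rintegral => t _; by rewrite /G circE lnK ?posrE.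
Qed.

Lemma circ_punctured z r t rho : 0 < r -> r < rho -> 0 < cmod (circ z r t - z) < rho.
Proof. by move=> r0 rr; rewrite cmod_circ ?r0// ltW. Qed.

(** The mean value property. Only continuity is asked at the centre, since the
    exponential coordinates do not see it; this replaces the theorem on
    removable singularities for difference quotients. *)
Lemma cavg_hol g z rho r : 0 < r -> r < rho ->
  (forall w, 0 < cmod (w - z) < rho -> hol g w) -> {for z, continuous g} ->
  cavg (fun w => Re (g w)) z r = Re (g z).
Proof.
move=> r0 rr hg cg.
have cR : {for z, continuous (fun x => Re (g x))}.
  by apply: (@continuous_comp _ _ _ g Re z); [exact: cg|exact: Re_cont].
apply/eqP; rewrite -subr_eq0 -normr_le0; apply/ler_addgt0Pl => e e0; rewrite addr0.
move/rcont_cdiscP: cR => /(_ e e0)[d d0 H].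
pose r1 := Num.min r (d / 2).
have r10 : 0 < r1 by rewrite lt_min r0 divr_gt0.
have r1r : r1 <= r by rewrite ge_min lexx.
have r1d : r1 < d by rewrite gt_min; apply/orP; right; rewrite gtr_pMr// invf_lt1// ltr1n.
rewrite -(cavg_indep r10 r1r rr hg).
have := @rintegral_near_cst R 0 (pi *+ 2) (fun t => Re (g (circ z r1 t))) (Re (g z)) e (ltW pi2_gt0).
have c1 : {within `[0, pi *+ 2], continuous (fun t => Re (g (circ z r1 t)))}.
  apply: (@cont_on_circ (fun w => Re (g w))) => t; apply: Re_hol_cont; apply: hg.
  by apply: circ_punctured => //; exact: le_lt_trans rr.
move=> /(_ c1) h.
have {}h := h (fun t _ => ltW (H _ _)).
rewrite subr0 in h.
have p0 := pi2_gt0; have p0' := lt0r_neq0 p0.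
rewrite /cavg -[X in _ - X](mulfK p0') -mulrBl normrM normrV ?unitfE//.
rewrite (gtr0_norm p0) ler_pdivrMr//.
by apply: h => t; rewrite cmod_circ// ltW.
Qed.

End Mean.

(** * The maximum principle and the gradient estimate *)

Section MaxP.
Local Open Scope complex_scope.
Variable R : realType.
Local Notation C := (Cplx R).
Local Notation Re := (@complex.Re R).
Local Notation Im := (@complex.Im R).
Implicit Types (z w : C) (r e t : R) (g k h : C -> C) (F G : C -> R).

Lemma mvp_le g z rho r (m : R) : 0 < r -> r < rho ->
  (forall w, 0 < cmod (w - z) < rho -> hol g w) -> {for z, continuous g} ->
  (forall w, cmod (w - z) = r -> Re (g w) <= m) -> Re (g z) <= m.
Proof.
move=> r0 rr hg cg H; rewrite -(cavg_hol r0 rr hg cg) -[leRHS](cavg_cst m z r).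
apply: le_cavg => //; first exact: ltW.
  by move=> t; apply: Re_hol_cont; apply: hg; exact: circ_punctured.
by move=> t; exact: cst_continuous.
Qed.

(** Rotates z to the positive axis, so that a modulus becomes a real part. *)
Lemma unimodular_rotation z : exists2 c : C, cmod c = 1 & c * z = (cmod z)%:C.
Proof.
have [->|z0] := eqVneq z 0; first by exists 1; rewrite ?cmod1// mulr0 cmod0.
exists ((cmod z)%:C / z); last by rewrite mulfVK.
by rewrite cmodM cmodV cmod_real ger0_norm ?cmod_ge0// mulfV// cmod_eq0.
Qed.

Lemma conjc_mod z : z * conjc z = (cmod z ^+ 2)%:C.
Proof.
case: z => x y; apply: cplx_eq => /=; last by ring.
by rewrite sqr_sqrtr ?addr_ge0 ?sqr_ge0//; ring.
Qed.

Lemma cmod_sqrD z w : cmod (z + w) ^+ 2 = cmod z ^+ 2 + cmod w ^+ 2 + 2 * Re (conjc z * w).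
Proof.
by case: z w => [x y] [a b]; rewrite /= !sqr_sqrtr ?addr_ge0 ?sqr_ge0//; ring.
Qed.

(** Isolated points where g is merely continuous are allowed. If |g| exceeded m
    somewhere then |g| + e|z|^2, for a small e > 0, would attain its maximum at
    an interior point p. Writing |w|^2 = |p|^2 + |w - p|^2 + 2 Re (conj p (w - p))
    gives Re (c g(w) + 2e conj p (w - p)) <= |g(p)| - e r^2 on the circle
    |w - p| = r, while the mean value of the left-hand side is |g(p)|. The strict
    gain e r^2 avoids any discussion of equality. *)
Lemma max_principle (K : set C) g (m : R) : compact K ->
  (forall z, K z -> {for z, continuous g}) ->
  (forall z, K z -> cmod (g z) <= m \/ exists2 rho, 0 < rho &
     forall w, cmod (w - z) < rho -> K w /\ (w != z -> hol g w)) ->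
  forall z, K z -> cmod (g z) <= m.
Proof.
move=> cK cg H z1 Kz1; rewrite leNgt; apply/negP => gz1.
have [b Kb bmax] := EVT_max_plane Kz1 cK (fun z _ => @cmod_cont R z).
pose B := cmod b ^+ 2.
have B0 : 0 <= B by rewrite sqr_ge0.
have zB z : K z -> cmod z ^+ 2 <= B.
  by move=> Kz; rewrite ler_sqr ?nnegrE ?cmod_ge0//; exact: bmax.
pose e := (cmod (g z1) - m) / (2 * (B + 1)).
have B1 : 0 < 2 * (B + 1) by lra.
have e0 : 0 < e by rewrite divr_gt0// subr_gt0.
have eB : e * B < cmod (g z1) - m.
  rewrite /e mulrAC ltr_pdivrMr// ltr_pM2l ?subr_gt0//; lra.
pose Phi z := cmod (g z) + e * cmod z ^+ 2.
have cPhi z : K z -> {for z, continuous Phi}.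
  move=> Kz.
  have c1 : {for z, continuous (fun w => cmod (g w))}.
    by apply: (@continuous_comp _ _ _ g (fun w : C => cmod w) z); [exact: cg|exact: cmod_cont].
  have c2 : {for z, continuous (fun w : C => cmod w * cmod w)}.
    by apply: (@continuousM R C _ _ z); exact: cmod_cont.
  have c3 : {for z, continuous (fun w : C => e * (cmod w * cmod w))}.
    by apply: (@continuousM R C (fun=> e) _ z) => //; exact: cst_continuous.
  exact: (@continuousD R R C _ _ z c1 c3).
have [p Kp pmax] := EVT_max_plane Kz1 cK cPhi.
have gp : m < cmod (g p).
  have := pmax _ Kz1; have := zB _ Kp; rewrite /Phi => h1 h2.
  have : e * cmod p ^+ 2 <= e * B by rewrite ler_pM2l.
  have : 0 <= e * cmod z1 ^+ 2 by rewrite mulr_ge0 ?sqr_ge0// ltW.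
  lra.
have [|[rho rho0 Hr]] := H _ Kp; first by rewrite leNgt gp.
have [c c1 cgp] := unimodular_rotation (g p).
pose G w := c * g w + (2 * e)%:C * (conjc p * (w - p)).
have hl w : hol (fun w => (2 * e)%:C * (conjc p * (w - p))) w.
  apply: (@holM R (fun=> (2 * e)%:C) (fun w => conjc p * (w - p))); first exact: hol_cst.
  apply: (@holM R (fun=> conjc p) (fun w => w - p)); first exact: hol_cst.
  by apply: (@holB R id (fun=> p)); [exact: hol_id|exact: hol_cst].
have hG w : 0 < cmod (w - p) < rho -> hol G w.
  rewrite cmod_gt0 subr_eq0 => /andP[w0 /Hr[_ /(_ w0) hgw]].
  apply: (@holD R (fun w => c * g w)); last exact: hl.
  by apply: (@holM R (fun=> c)) => //; exact: hol_cst.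
have cG : {for p, continuous G}.
  apply: (@continuousD C C C (fun w => c * g w) _ p); last exact: (hol_cont (hl p)).
  by apply: (@continuousM C C (fun=> c) g p); [exact: cst_continuous|exact: cg].
pose r := rho / 2.
have r0 : 0 < r by rewrite divr_gt0.
have rr : r < rho by rewrite /r; lra.
suff K' : forall w, cmod (w - p) = r -> Re (G w) <= cmod (g p) - e * r ^+ 2.
  have := mvp_le r0 rr hG cG K'.
  rewrite /G subrr !mulr0 addr0 cgp /=.
  have : 0 < e * r ^+ 2 by rewrite mulr_gt0// exprn_gt0.
  lra.
move=> w wr; have [|Kw _] := Hr w; first by rewrite wr.
have := pmax _ Kw; rewrite /Phi.
have -> : cmod w ^+ 2 = cmod p ^+ 2 + r ^+ 2 + 2 * Re (conjc p * (w - p)).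
  by rewrite -wr -cmod_sqrD addrC subrK.
have : Re (c * g w) <= cmod (g w).
  by apply: le_trans (ler_norm _) (le_trans (Re_le_cmod _) _); rewrite cmodM c1 mul1r.
have -> : Re (G w) = Re (c * g w) + 2 * e * Re (conjc p * (w - p)).
  by rewrite /G cReD; congr (_ + _); rewrite cReM /= mul0r subr0.
lra.
Qed.

(** The difference quotient of g at z, completed by the value l. When l is the
    derivative of g at z it is continuous at z, which is all that
    [cavg_hol] and [max_principle] require. *)
Definition slope g z (l : C) w : C := if w == z then l else (g w - g z) / (w - z).

Lemma slope_hol g z l w : w != z -> hol g w -> hol (slope g z l) w.
Proof.
move=> wz gw; have wz0 : w - z != 0 by rewrite subr_eq0.
apply: (@hol_local R (fun w => (g w - g z) / (w - z)) _ w (cmod (w - z))).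
- by rewrite cmod_gt0.
- move=> x xw; rewrite /slope; case: eqP => // xz; move: xw.
  by rewrite xz cmodB ltxx.
- apply: (@holM R (fun w => g w - g z) (fun w => (w - z)^-1)).
    by apply: (@holB R g (fun=> g z)) => //; exact: hol_cst.
  apply: (@holV R (fun w => w - z) w wz0).
  by apply: (@holB R id (fun=> z)); [exact: hol_id|exact: hol_cst].
Qed.

Lemma slope_cont g z l : cdiff g z l -> {for z, continuous (slope g z l)}.
Proof.
move=> gl; apply/cont_cdiscP => e e0.
have [d d0 H] := gl (e / 2) (divr_gt0 e0 (ltr0Sn _ 1)).
exists d => // w wd; rewrite /slope eqxx; case: eqVneq => [_|wz].
  by rewrite subrr cmod0.
have wz0 : w - z != 0 by rewrite subr_eq0.
have -> : (g w - g z) / (w - z) - l = (g w - g z - l * (w - z)) / (w - z) by field.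
rewrite cmodM cmodV ltr_pdivrMr ?cmod_gt0//.
apply: le_lt_trans (H _ wd) _; rewrite ltr_pM2r ?cmod_gt0//; lra.
Qed.

Lemma slopeE g z l w : g w = g z + slope g z l w * (w - z).
Proof.
rewrite /slope; case: eqVneq => [->|wz]; first by rewrite subrr mulr0 addr0.
by rewrite divfK ?subr_eq0// addrC subrK.
Qed.

(** On the circle the functions (h - h(z)) / (w - z) and
    (h - h(z)) (w - z) / r^2 have kernels that are conjugate to each other, so
    after rotation by c and conj c the sum of their real parts is
    2 Re (c / (w - z)) Re (h - h(z)), at most (2/r) Re (h + h(z)). At the centre
    the first function is h'(z) and the second one vanishes. *)
Lemma gradient h z l rho r : 0 < r -> r < rho ->
  (forall w, cmod (w - z) < rho -> hol h w) ->
  (forall w, cmod (w - z) < rho -> 0 <= Re (h w)) ->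
  cdiff h z l -> cmod l * r <= 4 * Re (h z).
Proof.
move=> r0 rr hh hp hl.
have rho0 : 0 < rho by exact: lt_trans rr.
have [c c1 cl] := unimodular_rotation l.
have hz : hol h z by apply: hh; rewrite subrr cmod0.
have r20 : 0 < r ^+ 2 by rewrite exprn_gt0.
pose q1 w := c * slope h z l w.
pose q2 w := conjc c * (r ^- 2)%:C * ((h w - h z) * (w - z)).
pose q3 w := (2 / r)%:C * (h w + h z).
pose q w := q1 w + q2 w - q3 w.
have hq2 w : cmod (w - z) < rho -> hol q2 w.
  move=> wr; apply: (@holM R (fun=> _)); first exact: hol_cst.
  apply: (@holM R (fun w => h w - h z) (fun w => w - z)).
    by apply: (@holB R h (fun=> h z)); [exact: hh|exact: hol_cst].
  by apply: (@holB R id (fun=> z)); [exact: hol_id|exact: hol_cst].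
have hq3 w : cmod (w - z) < rho -> hol q3 w.
  move=> wr; apply: (@holM R (fun=> _)); first exact: hol_cst.
  by apply: (@holD R h (fun=> h z)); [exact: hh|exact: hol_cst].
have hq1 w : 0 < cmod (w - z) < rho -> hol q1 w.
  rewrite cmod_gt0 subr_eq0 => /andP[w0 wr].
  apply: (@holM R (fun=> c)); first exact: hol_cst.
  by apply: slope_hol => //; exact: hh.
have zz : cmod (z - z) < rho by rewrite subrr cmod0.
have cq1 : {for z, continuous q1}.
  by apply: (@continuousM C C (fun=> c) _ z); [exact: cst_continuous|exact: slope_cont].
have cq : {for z, continuous q}.
  apply: (@continuousB C C C (fun w => q1 w + q2 w) q3 z).
    by apply: (@continuousD C C C q1 q2 z cq1); apply: hol_cont; exact: hq2.
  by apply: hol_cont; exact: hq3.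
have hq w : 0 < cmod (w - z) < rho -> hol q w.
  move=> wr; have /andP[_ wr'] := wr.
  apply: (@holB R (fun w => q1 w + q2 w) q3); last exact: hq3.
  by apply: (@holD R q1 q2); [exact: hq1|exact: hq2].
suff K : forall w, cmod (w - z) = r -> Re (q w) <= 0.
  have := mvp_le r0 rr hq cq K.
  have -> : Re (q z) = cmod l - 4 / r * Re (h z).
    rewrite /q /q1 /q2 /q3 /slope eqxx !subrr mul0r mulr0 addr0 cl.
    by rewrite cReD cReN cReM cReD /=; ring.
  by rewrite subr_le0 mulrAC ler_pdivlMr.
move=> w wr; have wr' : cmod (w - z) < rho by rewrite wr.
have w0 : w - z != 0 by rewrite -cmod_gt0 wr.
have wz : w != z by rewrite -subr_eq0.
pose kk := c / (w - z).
have e1 : q1 w = kk * (h w - h z).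
  by rewrite /q1 /slope (negbTE wz) /kk; field.
have e2 : q2 w = conjc kk * (h w - h z).
  rewrite /q2 /kk.
  have -> : conjc (c / (w - z)) = conjc c * (conjc (w - z))^-1.
    by rewrite -conjc_inv; case: (c) ((w - z)^-1) => [? ?] [? ?]; apply: cplx_eq => /=; ring.
  have cz0 : conjc (w - z) != 0 by rewrite conjc_eq0.
  have -> : (r ^- 2)%:C = ((w - z) * conjc (w - z))^-1.
    by rewrite conjc_mod wr -fmorphV.
  move: (conjc c) (h w - h z) (conjc (w - z)) cz0 => a b y y0.
  by move: (w - z) w0 => x x0; field; rewrite x0 y0.
have hw := hp _ wr'; have hz0 := hp _ zz.
have kr : `|Re kk| <= r^-1.
  by apply: le_trans (Re_le_cmod _) _; rewrite /kk cmodM cmodV wr c1 mul1r.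
have : `|Re kk * (Re (h w) - Re (h z))| <= r^-1 * (Re (h w) + Re (h z)).
  rewrite normrM ler_pM//; apply: le_trans (ler_normB _ _) _.
  by rewrite !ger0_norm.
move=> /(le_trans (ler_norm _)).
have -> : Re (q w) = 2 * (Re kk * (Re (h w) - Re (h z)) - r^-1 * (Re (h w) + Re (h z))).
  rewrite /q e1 e2 /q3; case: (kk) (h w) (h z) => [k1 k2] [x1 x2] [y1 y2] /=; field.
  by rewrite gt_eqF.
lra.
Qed.

End MaxP.

(** * Holomorphic logarithms and Harnack's inequality *)

Section Harnack.
Local Open Scope complex_scope.
Variable R : realType.
Local Notation C := (Cplx R).
Local Notation Re := (@complex.Re R).
Local Notation Im := (@complex.Im R).
Implicit Types (z w : C) (r e t : R) (g k h : C -> C) (F G : C -> R).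

Lemma cexp_surj z : z != 0 -> exists w, cexp w = z.
Proof.
move=> z0; have m0 : 0 < cmod z by rewrite cmod_gt0.
have [|w] := @cexp_onto_circle R (ln (cmod z))%:C z.
  by rewrite cmod_cexp /= lnK ?posrE.
by exists w.
Qed.

(** Heine's theorem, with the second point allowed outside K. *)
Lemma unif_cont (K : set C) g e : compact K -> (forall z, K z -> {for z, continuous g}) ->
  0 < e -> exists2 d, 0 < d & forall z w, K z -> cmod (w - z) < d -> cmod (g w - g z) < e.
Proof.
move=> /compact_near_coveringP cK cg e0.
have e20 : 0 < e / 2 by rewrite divr_gt0.
have [z Kz|N _ H] := cK nat \oo (fun n z => forall w, cmod (w - z) < n.+1%:R^-1 ->
    cmod (g w - g z) < e) eventually_filter.
- have /cont_cdiscP/(_ _ e20)[d d0 Hd] := cg z Kz.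
  have d20 : 0 < d / 2 by rewrite divr_gt0.
  exists ([set z' : C | cmod (z' - z) < d / 2], [set n | n.+1%:R^-1 < d / 2]).
    split => /=; first by apply/nbhs_cdisc; exists (d / 2).
    exact: near_infty_natSinv_lt (PosNum d20).
  move=> [z' n] /= [zz' nd] w wz'.
  have h1 : cmod (w - z) < d.
    have -> : w - z = (w - z') + (z' - z) by rewrite addrA subrK.
    apply: le_lt_trans (cmodD _ _) _; have := lt_trans wz' nd; lra.
  have h2 : cmod (z' - z) < d by lra.
  have -> : g w - g z' = (g w - g z) - (g z' - g z) by rewrite opprB addrA subrK.
  apply: le_lt_trans (cmodD _ _) _; rewrite cmodN.
  have := Hd _ h1; have := Hd _ h2; lra.
- exists N.+1%:R^-1; first by rewrite invr_gt0.
  by move=> z w Kz; apply: (H N) => //=.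
Qed.

(** Cut each radius into so many equal parts that the values of g at consecutive
    points have a ratio within 1 of 1, and add the principal logarithms of these
    ratios. *)
Lemma hol_log g x rho r : 0 < r -> r < rho ->
  (forall w, cmod (w - x) < rho -> hol g w) ->
  (forall w, cmod (w - x) < rho -> g w != 0) ->
  exists h, forall w, cmod (w - x) < r -> hol h w /\ cexp (h w) = g w.
Proof.
move=> r0 rr hg g0.
pose K := [set w : C | cmod (w - x) <= r].
have Kr w : K w -> cmod (w - x) < rho by move=> /le_lt_trans; apply.
have cK : compact K by exact: closed_disc_compact.
have Kx : K x by rewrite /K /= subrr cmod0 ltW.
have cg z : K z -> {for z, continuous g} by move=> /Kr/hg/hol_cont.
have [b Kb bmin] : exists2 b, K b & forall z, K z -> cmod (g b) <= cmod (g z).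
  have [|b Kb H] := @EVT_max_plane R K (fun z => - cmod (g z)) x Kx cK.
    move=> z Kz; apply: (@continuousN R R C (fun z => cmod (g z)) z).
    by apply: (@continuous_comp _ _ _ g (fun w : C => cmod w) z); [exact: cg|exact: cmod_cont].
  by exists b => // z /H; rewrite lerN2.
pose m := cmod (g b).
have m0 : 0 < m by rewrite cmod_gt0; apply: g0; exact: Kr.
have [d d0 Hd] := unif_cont cK cg m0.
have [n nd] : exists n, r / n.+1%:R < d.
  exists (Num.bound (r / d)); rewrite ltr_pdivrMr// mulrC -ltr_pdivrMr//.
  apply: lt_trans (archi_boundP _) _; first by rewrite divr_ge0 ?ltW.
  by rewrite ltr_nat.
have n0 : n.+1%:R != 0 :> R by rewrite pnatr_eq0.
pose p (j : nat) w := seg x w (j%:R / n.+1%:R).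
have pK j w : (j <= n.+1)%N -> K w -> K (p j w).
  move=> jn Kw; rewrite /K /= /p -{2}(seg0 x w) cmod_segB subr0 ger0_norm ?divr_ge0//.
  by apply: le_trans Kw; rewrite ler_piMl ?cmod_ge0// ler_pdivrMr// mul1r ler_nat.
have pstep j w : K w -> cmod (p j.+1 w - p j w) < d.
  move=> Kw; rewrite /p cmod_segB -mulrBl -natrB// subSnn mul1r ger0_norm ?invr_ge0//.
  by apply: le_lt_trans nd; rewrite mulrC ler_pM2r ?invr_gt0.
have hp j w : hol (p j) w.
  apply: (@holD R (fun=> x)); first exact: hol_cst.
  apply: (@holM R (fun=> _) (fun w => w - x)); first exact: hol_cst.
  by apply: (@holB R id (fun=> x)); [exact: hol_id|exact: hol_cst].
have [c0 Hc0] : exists c, cexp c = g x.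
  by apply: cexp_surj; apply: g0; exact: Kr.
pose q j w := g (p j.+1 w) / g (p j w).
have q1 j w : (j <= n)%N -> K w -> 0 < Re (q j w).
  move=> jn Kw.
  have kj : K (p j w) by apply: pK => //; exact: leqW.
  have gj := g0 _ (Kr _ kj).
  have : cmod (q j w - 1) < 1.
    have -> : q j w - 1 = (g (p j.+1 w) - g (p j w)) / g (p j w) by rewrite /q; field.
    rewrite cmodM cmodV ltr_pdivrMr ?cmod_gt0// mul1r.
    by apply: lt_le_trans (Hd _ _ kj (pstep _ _ Kw)) _; exact: bmin.
  move=> /(le_lt_trans (Re_le_cmod _)); rewrite cReD cReN /= ltr_norml => /andP[h _]; lra.
pose h w := c0 + \sum_(j < n.+1) Log (q j w).
have hq j w : (j <= n)%N -> K w -> hol (q j) w.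
  move=> jn Kw.
  apply: (@holM R (fun w => g (p j.+1 w)) (fun w => (g (p j w))^-1)).
    apply: (@hol_comp R (p j.+1) g w (hp _ _)).
    by apply: hg; apply: Kr; apply: pK.
  apply: (@holV R (fun w => g (p j w))).
    by apply: g0; apply: Kr; apply: pK => //; exact: leqW.
  apply: (@hol_comp R (p j) g w (hp _ _)).
  by apply: hg; apply: Kr; apply: pK => //; exact: leqW.
exists h => w wr; have Kw : K w by exact: ltW.
split.
  apply: (@holD R (fun=> c0)); first exact: hol_cst.
  apply: (@hol_sum R _ _ (fun (j : 'I_n.+1) w => Log (q j w))) => j.
  have jn : (j <= n)%N by rewrite -ltnS.
  by apply: (@hol_comp R (q j) (@Log R)); [exact: hq|apply: hol_Log; exact: q1].
have part j : (j <= n.+1)%N -> cexp (c0 + \sum_(i < j) Log (q i w)) = g (p j w).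
  elim: j => [|j IH] jn; first by rewrite big_ord0 addr0 /p mul0r seg0.
  have -> : c0 + \sum_(i < j.+1) Log (q i w) = (c0 + \sum_(i < j) Log (q i w)) + Log (q j w).
    by rewrite big_ord_recr addrA.
  have jn' : (j <= n)%N by [].
  rewrite cexpD (IH (ltnW jn)) (cexp_Log (q1 j w jn' Kw)).
  have kj : K (p j w) by apply: pK => //; exact: ltnW.
  by have gj := g0 _ (Kr _ kj); rewrite /q mulrC divfK.
by rewrite /h part// /p divff// seg1.
Qed.

Lemma real_is_derive (f : R -> R) (x l : R) :
  (forall e, 0 < e -> exists2 d, 0 < d & forall y, `|y - x| < d ->
    `|f y - f x - l * (y - x)| <= e * `|y - x|) -> is_derive x 1 f l.
Proof.
move=> H.
have fl : (h^-1 *: (f (h *: 1 + x) - f x)) @[h --> 0^'] --> l.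
  apply/cvgrPdist_le => e e0; have [d d0 Hd] := H e e0.
  rewrite /prop_near1 /nbhs/= /dnbhs/= /within/=; apply/nbhs_ballP; exists d => // y.
  rewrite /ball/= sub0r normrN => yd y0.
  have := Hd (y + x); rewrite addrK => /(_ yd) h.
  rewrite [_ *: 1]mulr1 (_ : _ - _ = - (y^-1 * (f (y + x) - f x - l * y))).
    rewrite normrN normrM normrV ?unitfE// ler_pdivrMl ?normr_gt0//.
    by rewrite [leRHS]mulrC.
  by rewrite /GRing.scale /=; field.
split; first by apply/cvg_ex; exists l.
exact: cvg_lim fl.
Qed.

Lemma seg_derive g (a b l : C) t : cdiff g (seg a b t) l ->
  is_derive t 1 (fun t => Re (g (seg a b t))) (Re (l * (b - a))).
Proof.
move=> gl; apply: real_is_derive => e e0.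
have B0 : 0 < cmod (b - a) + 1 by rewrite ltr_wpDl ?cmod_ge0.
have [d d0 H] := gl (e / (cmod (b - a) + 1)) (divr_gt0 e0 B0).
exists (d / (cmod (b - a) + 1)); first by rewrite divr_gt0.
move=> s hs; have sb : `|s - t| * cmod (b - a) <= `|s - t| * (cmod (b - a) + 1).
  by rewrite ler_wpM2l// lerDl.
have := H (seg a b s); rewrite cmod_segB => /(_ _)h.
have {}h := h (le_lt_trans sb (_ : _ < d)).
have {h} : cmod (g (seg a b s) - g (seg a b t) - l * (seg a b s - seg a b t)) <= e * `|s - t|.
  apply: le_trans (h _) _; first by rewrite -ltr_pdivlMr.
  apply: le_trans (ler_wpM2l _ sb) _; first by rewrite divr_ge0// ltW.
  by rewrite mulrCA divfK ?gt_eqF// mulrC.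
apply: le_trans; apply: le_trans (Re_le_cmod _).
have -> : seg a b s - seg a b t = (s - t)%:C * (b - a).
  by rewrite /seg opprD addrACA subrr add0r -mulrBl -rmorphB.
have e1 : l * ((s - t)%:C * (b - a)) = (s - t)%:C * (l * (b - a)) by rewrite mulrCA.
rewrite e1 2!cReD 2!cReN [X in _ <= `|_ - X|]cReM [Re (s - t)%:C]/= [Im (s - t)%:C]/=.
by rewrite mul0r subr0 [_ * (s - t)]mulrC.
Qed.

Lemma seg_MVT_bound (f df : R -> R) (m : R) :
  (forall t, 0 <= t <= 1 -> is_derive t 1 f (df t)) ->
  (forall t, 0 <= t <= 1 -> `|df t| <= m) -> `|f 1 - f 0| <= m.
Proof.
move=> fd dfm.
have [||t] := @MVT R f df 0 1 ltr01.
- by move=> t; rewrite in_itv/= => /andP[t0 t1]; apply: fd; rewrite !ltW.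
- by apply: derivable_within_continuous => t; rewrite in_itv/= => /fd [].
rewrite in_itv/= => /andP[t0 t1] ->; rewrite subr0 mulr1; apply: dfm.
by rewrite !ltW.
Qed.

End Harnack.

Section Schottky.
Local Open Scope complex_scope.
Variable R : realType.
Local Notation C := (Cplx R).
Local Notation Re := (@complex.Re R).
Local Notation Im := (@complex.Im R).
Implicit Types (z w : C) (r e t : R) (g k h : C -> C) (F G : C -> R).

Local Notation K := (expR 2 : R).

(** Harnack's inequality, obtained by integrating the gradient estimate
    |h'| <= 8 Re h / rho along a segment of length at most rho / 4: the logarithm
    of Re h varies by at most 2. *)
Lemma harnack_pos_real_part h x rho z : 0 < rho ->
  (forall w, cmod (w - x) < rho -> hol h w) ->
  (forall w, cmod (w - x) < rho -> 0 < Re (h w)) ->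
  cmod (z - x) <= rho / 4 ->
  [/\ Re (h z) <= K * Re (h x), Re (h x) <= K * Re (h z) &
      cmod (h z - h x) <= 2 * K * Re (h x)].
Proof.
move=> rho0 hh hp.
have gr w l : cmod (w - x) <= rho / 4 -> cdiff h w l -> cmod l * rho <= 8 * Re (h w).
  move=> wx hl.
  have sub y : cmod (y - w) < 3 * rho / 4 -> cmod (y - x) < rho.
    move=> yw; have -> : y - x = (y - w) + (w - x) by rewrite addrA subrK.
    by apply: le_lt_trans (cmodD _ _) _; lra.
  have := @gradient R h w l (3 * rho / 4) (rho / 2).
  move=> /(_ _ _ (fun y yw => hh y (sub y yw)) (fun y yw => ltW (hp y (sub y yw))) hl) H.
  have : cmod l * (rho / 2) <= 4 * Re (h w) by apply: H; lra.
  lra.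
have lt4 w : cmod (w - x) <= rho / 4 -> cmod (w - x) < rho by lra.
have sgx w t : 0 <= t <= 1 -> cmod (w - x) <= rho / 4 -> cmod (seg x w t - x) <= rho / 4.
  move=> /andP[t0 t1] wx; rewrite -{2}(seg0 x w) cmod_segB subr0 ger0_norm//.
  by apply: le_trans wx; rewrite ler_piMl// cmod_ge0.
have der w : cmod (w - x) <= rho / 4 ->
    exists l : R -> C, forall t, 0 <= t <= 1 -> cdiff h (seg x w t) (l t).
  move=> wx; exists (fun t => get (fun l : C => cdiff h (seg x w t) l)) => t tI.
  have /holP : hol h (seg x w t) by apply: hh; apply: lt4; exact: sgx.
  by move=> [l0 hl0]; case: xgetP => [y _ //|/(_ l0)].
have dbound w l t : 0 <= t <= 1 -> cmod (w - x) <= rho / 4 -> cdiff h (seg x w t) l ->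
    `|Re (l * (w - x))| <= 2 * Re (h (seg x w t)).
  move=> tI wx hl; apply: le_trans (Re_le_cmod _) _; rewrite cmodM.
  have := gr _ _ (sgx _ _ tI wx) hl => h1.
  have : cmod l * cmod (w - x) <= cmod l * (rho / 4) by rewrite ler_wpM2l ?cmod_ge0.
  lra.
have harn w : cmod (w - x) <= rho / 4 -> Re (h w) <= K * Re (h x) /\ Re (h x) <= K * Re (h w).
  move=> wx.
  have xx : cmod (x - x) <= rho / 4 by rewrite subrr cmod0 divr_ge0// ltW.
  have : `|ln (Re (h w)) - ln (Re (h x))| <= 2.
    have [l lP] := der w wx.
    have := @seg_MVT_bound R (fun t => ln (Re (h (seg x w t))))
      (fun t => (Re (h (seg x w t)))^-1 * Re (l t * (w - x))) 2.
    rewrite /= seg0 seg1; apply => t tI.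
      have u0 : 0 < Re (h (seg x w t)) by apply: hp; apply: lt4; exact: sgx.
      have dl := is_derive1_ln u0.
      have ds := seg_derive (lP t tI).
      have := @is_derive1_comp R (@ln R) (fun t => Re (h (seg x w t))) t _ _ dl ds.
      by [].
    have u0 : 0 < Re (h (seg x w t)) by apply: hp; apply: lt4; exact: sgx.
    rewrite normrM normrV ?unitfE ?gt_eqF// (gtr0_norm u0) ler_pdivrMl// [leRHS]mulrC.
    exact: (dbound w (l t) t tI wx (lP t tI)).
  have u0 := hp _ (lt4 _ wx); have v0 := hp _ (lt4 _ xx).
  rewrite ler_norml => /andP[l1 l2].
  rewrite -[Re (h w)]lnK ?posrE// -[Re (h x)]lnK ?posrE// -!expRD !ler_expR; split; lra.
move=> zx; have [h1 h2] := harn z zx; split=> //.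
have [c c1 cz] := unimodular_rotation (h z - h x).
have ch w l : cdiff h w l -> cdiff (fun w => c * h w) w (c * l).
  move=> hl e e0; have [d d0 H] := hl e e0; exists d => // y yw.
  by rewrite -mulrBr -mulrA -mulrBr cmodM c1 mul1r; exact: H.
have : `|Re (c * h z) - Re (c * h x)| <= 2 * K * Re (h x).
  have [l lP] := der z zx.
  have := @seg_MVT_bound R (fun t => Re (c * h (seg x z t)))
      (fun t => Re (c * l t * (z - x))) (2 * K * Re (h x)).
  rewrite /= seg0 seg1; apply => t tI.
    exact: (@seg_derive R (fun w => c * h w) x z _ t (ch _ _ (lP t tI))).
  have s1 := sgx _ _ tI zx; have [h3 _] := harn _ s1.
  apply: le_trans (Re_le_cmod _) _; rewrite -mulrA !cmodM c1 mul1r.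
  have h4 := gr _ _ s1 (lP t tI).
  have : cmod (l t) * cmod (z - x) <= cmod (l t) * (rho / 4) by rewrite ler_wpM2l ?cmod_ge0.
  lra.
have -> : Re (c * h z) - Re (c * h x) = cmod (h z - h x).
  by rewrite -cReN -cReD -mulrBr cz.
by rewrite ger0_norm ?cmod_ge0.
Qed.

(** Harnack's inequality for log |g|, the real part of a logarithm of g. *)
Lemma harnack_log_modulus g x rho z : 0 < rho ->
  (forall w, cmod (w - x) < rho -> hol g w) ->
  (forall w, cmod (w - x) < rho -> 1 < cmod (g w)) ->
  cmod (z - x) <= rho / 8 ->
  ln (cmod (g z)) <= K * ln (cmod (g x)) /\ ln (cmod (g x)) <= K * ln (cmod (g z)).
Proof.
move=> rho0 hg g1 zx.
have [||||h Hh] := @hol_log R g x rho (rho / 2); [lra|lra|exact: hg| |].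
  by move=> w /g1 h; rewrite -cmod_gt0 (lt_trans _ h).
have Rh w : cmod (w - x) < rho / 2 -> Re (h w) = ln (cmod (g w)).
  by move=> /Hh[_ <-]; rewrite cmod_cexp expRK.
have xx : cmod (x - x) < rho / 2 by rewrite subrr cmod0 divr_gt0.
have [||||h1 h2 _] := @harnack_pos_real_part h x (rho / 2) z.
- lra.
- by move=> w /Hh[].
- by move=> w wx; rewrite Rh// ln_gt0// g1//; lra.
- lra.
by move: h1 h2; rewrite !Rh//; lra.
Qed.

(** A weak form of Schottky's theorem. Let h be a logarithm of g and o a
    logarithm of w0 at distance at most pi from h(x). By Harnack's
    inequality |h - o| is at most B, of the order of log |g(x)|. Since h - o has
    no zero, B / (h - o) is a function of modulus greater than 1 whose logarithm
    at x is at least log (B / pi), which tends to infinity with |g(x)|. Harnack's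
    inequality, applied a second time, shows that it is large near x; that is,
    |h - o| is small compared with log |g(x)|. *)
Lemma log_modulus_of_circle_omitting (e : R) : 0 < e -> exists L : R, forall g x rho (w0 : C), 0 < rho ->
  (forall w, cmod (w - x) < rho -> hol g w) ->
  (forall w, cmod (w - x) < rho -> 1 < cmod (g w)) ->
  (forall w, cmod (w - x) < rho -> g w != w0) ->
  cmod w0 = cmod (g x) -> L <= ln (cmod (g x)) ->
  forall z, cmod (z - x) <= rho / 64 ->
    `|ln (cmod (g z)) - ln (cmod (g x))| <= e * ln (cmod (g x)).
Proof.
move=> e0.
have K1 : 1 <= K by rewrite -[leLHS]expR0 ler_expR.
have p0 := pi_gt0 R.
pose T := ln (2 * (2 * K + 1) / e).
exists (Num.max (2 * pi) (Num.max (2 * pi / e) (pi * expR (K * T)))).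
move=> g x rho w0 rho0 hg g1 gw0 w0x; rewrite !ge_max => /andP[L1 /andP[L2 L3]] z zx.
have [||||h Hh] := @hol_log R g x rho (rho / 2); [lra|lra|exact: hg| |].
  by move=> w /g1 h; rewrite -cmod_gt0 (lt_trans _ h).
have Rh w : cmod (w - x) < rho / 2 -> Re (h w) = ln (cmod (g w)).
  by move=> /Hh[_ <-]; rewrite cmod_cexp expRK.
have xx : cmod (x - x) < rho / 2 by rewrite subrr cmod0 divr_gt0.
set lam := ln (cmod (g x)) in L1 L2 L3 *.
have lam0 : 0 < lam by lra.
have hx : Re (h x) = lam by rewrite Rh.
have near w : cmod (w - x) <= rho / 8 -> cmod (h w - h x) <= 2 * K * lam.
  move=> wx; rewrite -hx; have [||||_ _ //] := @harnack_pos_real_part h x (rho / 2) w.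
  - lra.
  - by move=> y /Hh[].
  - by move=> y yx; rewrite Rh// ln_gt0// g1//; lra.
  - lra.
have [|o ow ox] := @cexp_onto_circle R (h x) w0.
  by have [_ ->] := Hh _ xx.
have ho w : cmod (w - x) < rho / 8 -> h w - o != 0.
  move=> wx; have wr : cmod (w - x) < rho / 2 by lra.
  rewrite subr_eq0; apply: contraNneq (gw0 w _) => [E|]; last by lra.
  by have [_ <-] := Hh _ wr; rewrite E ow.
pose B := 2 * K * lam + 2 * pi.
have Kl : 0 < K * lam by rewrite mulr_gt0// expR_gt0.
have B0 : 0 < B by rewrite /B; lra.
(* the denominator has no zero, as g omits exp o = w0 *)
pose G w := B%:C / (h w - o).
have mG w : cmod (G w) = B / cmod (h w - o).
  by rewrite /G cmodM cmodV cmod_real gtr0_norm.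
have hoB w : cmod (w - x) < rho / 8 -> cmod (h w - o) < B.
  move=> wx; have -> : h w - o = (h w - h x) + (h x - o) by rewrite addrA subrK.
  apply: le_lt_trans (cmodD _ _) _; rewrite [X in _ + X]cmodB /B.
  by have := near _ (ltW wx); lra.
have G1 w : cmod (w - x) < rho / 8 -> 1 < cmod (G w).
  by move=> wx; rewrite mG ltr_pdivlMr ?mul1r ?hoB// cmod_gt0 ho.
have hG w : cmod (w - x) < rho / 8 -> hol G w.
  move=> wx; apply: (@holM R (fun=> B%:C) (fun w => (h w - o)^-1)); first exact: hol_cst.
  apply: (@holV R (fun w => h w - o)); first exact: ho.
  apply: (@holB R h (fun=> o)); last exact: hol_cst.
  by have [] := Hh w _ => //; lra.
have r8 : 0 < rho / 8 by lra.
have zx' : cmod (z - x) <= rho / 8 / 8 by lra.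
have [_ HG] := harnack_log_modulus r8 hG G1 zx'.
have zx8 : cmod (z - x) < rho / 8 by have := cmod_ge0 (z - x); lra.
have xx8 : cmod (x - x) < rho / 8 by rewrite subrr cmod0.
have oz0 : 0 < cmod (h z - o) by rewrite cmod_gt0 ho.
have ox0 : 0 < cmod (h x - o) by rewrite cmod_gt0 ho.
have T0 : 0 < 2 * (2 * K + 1) / e by rewrite divr_gt0//; lra.
have lB : K * T <= ln (B / pi).
  rewrite -[leLHS]expRK ler_ln ?posrE ?expR_gt0 ?divr_gt0//.
  rewrite ler_pdivlMr// mulrC; apply: le_trans L3 _; rewrite /B.
  have : lam <= K * lam by rewrite ler_peMl// ltW.
  lra.
have lGx : ln (B / pi) <= ln (cmod (G x)).
  rewrite ler_ln ?posrE ?divr_gt0 ?mG ?divr_gt0// ler_pM2l// lef_pV2 ?posrE//.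
  by rewrite cmodB.
have TG : T <= ln (cmod (G z)).
  by rewrite -(ler_pM2l (expR_gt0 2)); apply: le_trans lB (le_trans lGx HG).
have small : cmod (h z - o) <= e / 2 * lam.
  have : expR T <= cmod (G z).
    by rewrite -[leRHS]lnK ?posrE ?ler_expR// (lt_trans _ (G1 _ zx8)).
  rewrite /T lnK ?posrE// mG ler_pdivlMr// => h1.
  have : B <= (2 * K + 1) * lam by rewrite /B; lra.
  move=> /(le_trans h1); rewrite [leLHS](_ : _ = (2 * K + 1) * (2 / e * cmod (h z - o))); last first.
    by field; rewrite gt_eqF.
  rewrite ler_pM2l; last by lra.
  move=> h2; rewrite -(ler_pM2l (_ : 0 < 2 / e)) ?divr_gt0//.
  by rewrite [leRHS](_ : _ = lam)//; field; rewrite gt_eqF.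
have pis : pi <= e / 2 * lam.
  by move: L2; rewrite ler_pdivrMr//; lra.
have zr2 : cmod (z - x) < rho / 2 by have := cmod_ge0 (z - x); lra.
rewrite -(Rh z)// -hx -cReN -cReD; apply: le_trans (Re_le_cmod _) _.
have -> : h z - h x = (h z - o) + (o - h x) by rewrite addrA subrK.
apply: le_trans (cmodD _ _) _; rewrite hx; lra.
Qed.

End Schottky.

(** * The maximum modulus of an entire function *)

Section Entire.
Local Open Scope complex_scope.
Variable R : realType.
Local Notation C := (Cplx R).
Local Notation Re := (@complex.Re R).
Local Notation Im := (@complex.Im R).
Implicit Types (z w : C) (r e t : R) (g k h f : C -> C) (F G : C -> R).

Lemma cmod_comp_cont g z : {for z, continuous g} -> {for z, continuous (fun w => cmod (g w))}.
Proof.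
move=> cg; apply: (@continuous_comp _ _ _ g (fun w : C => cmod w) z); first exact: cg.
exact: cmod_cont.
Qed.

Lemma annulus_compact (a b : R) : compact [set z : C | a <= cmod z <= b].
Proof.
apply: (subclosed_compact _ (@closed_disc_compact R 0 b)).
  rewrite (_ : [set _ | _] = [set z : C | a <= cmod z] `&` [set z : C | cmod z <= b]).
    by apply: closedI; [apply: closed_superlevel => z; exact: cmod_cont|apply: closed_sublevel => z; exact: cmod_cont].
  by rewrite eqEsubset; split => z /=; [move=> /andP[]|move=> [-> ->]].
by move=> z /= /andP[_]; rewrite subr0.
Qed.

Section fixed.
Variable f : C -> C.
Hypothesis hf : forall z, hol f z.

Lemma max_modulusP r : 0 <= r ->
  (forall z, cmod z = r -> cmod (f z) <= max_modulus f r) /\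
  exists2 z, cmod z = r & cmod (f z) = max_modulus f r.
Proof.
move=> r0.
have rE : cmod (r%:C : C) = r by rewrite cmod_real ger0_norm.
pose A := [set z : C | r <= cmod z <= r].
have Ar : A r%:C by apply/andP; rewrite rE lexx.
have cfA z : A z -> {for z, continuous (fun z => cmod (f z))}.
  by move=> _; apply: cmod_comp_cont; apply: hol_cont.
have [b /= Hb bmax] := EVT_max_plane Ar (@annulus_compact r r) cfA.
have ub : ubound [set cmod (f z) | z in [set z : C | cmod z = r]] (cmod (f b)).
  by move=> _ [z /= zr <-]; apply: bmax; rewrite /A /= zr lexx.
have br : cmod b = r by apply/eqP; rewrite eq_le andbC.
have mE : max_modulus f r = cmod (f b).
  apply/eqP; rewrite eq_le; apply/andP; split.
    by apply: ge_sup => //; exists (cmod (f b)), b.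
  by apply: ub_le_sup; [exists (cmod (f b))|exists b].
split; last by exists b.
by move=> z zr; rewrite mE; apply: bmax; rewrite /A /= zr lexx.
Qed.

Lemma min_modulus_le z : min_modulus f (cmod z) <= cmod (f z).
Proof.
apply: ge_inf; last by exists z.
by exists 0 => _ [w _ <-]; exact: cmod_ge0.
Qed.

Lemma max_modulus_disc r z : cmod z <= r -> cmod (f z) <= max_modulus f r.
Proof.
move=> zr; have r0 : 0 <= r by apply: le_trans (cmod_ge0 _) zr.
have [H _] := max_modulusP r0.
apply: (@max_principle R [set w : C | cmod (w - 0) <= r]); last by rewrite /= subr0.
- exact: closed_disc_compact.
- by move=> w _; exact: hol_cont.
move=> w /=; rewrite subr0 le_eqVlt => /predU1P[wr|wr]; first by left; exact: H.
right; exists (r - cmod w); first by rewrite subr_gt0.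
move=> y yw; split; last by move=> _; exact: hf.
rewrite /= subr0; have := cmodD (y - w) w; rewrite subrK; lra.
Qed.

Lemma max_modulus_ge0 r : 0 <= r -> 0 <= max_modulus f r.
Proof. by move=> /max_modulusP[_ [z _ <-]]; exact: cmod_ge0. Qed.

Lemma max_modulus_mono r s : 0 <= r -> r <= s -> max_modulus f r <= max_modulus f s.
Proof.
by move=> /max_modulusP[_ [z zr <-]] rs; apply: max_modulus_disc; rewrite zr.
Qed.

End fixed.

Lemma punctured_disc_avoiding_seq (S : seq C) z : exists2 rho : R, 0 < rho &
  forall w, 0 < cmod (w - z) < rho -> w \notin S.
Proof.
elim: S => [|s S [rho rho0 H]]; first by exists 1.
have [sz|sz] := eqVneq s z.
  exists rho => // w /[dup] /H wS /andP[w0 _].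
  rewrite inE negb_or wS andbT; apply: contraTneq w0 => ->.
  by rewrite sz subrr cmod0 ltxx.
exists (Num.min rho (cmod (s - z))).
  by rewrite lt_min rho0 cmod_gt0 subr_eq0.
move=> w /andP[w0]; rewrite lt_min => /andP[wr ws].
rewrite inE negb_or H ?w0// andbT; apply: contraTneq ws => ->.
by rewrite ltxx.
Qed.

Lemma fresh_point (S : seq C) : exists x : C, x \notin S.
Proof.
have [rho rho0 H] := punctured_disc_avoiding_seq S 0.
exists ((rho / 2)%:C); apply: H.
by rewrite subr0 cmod_real gtr0_norm ?divr_gt0//; apply/andP; split; lra.
Qed.

Lemma slope_cont_ne g z l w : w != z -> {for w, continuous g} ->
  {for w, continuous (slope g z l)}.
Proof.
move=> wz cg; have wz0 : w - z != 0 by rewrite subr_eq0.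
have cq : {for w, continuous (fun w => (g w - g z) / (w - z))}.
  apply: (@cont_mul R (fun w => g w - g z) (fun w => (w - z)^-1)).
    by apply: (@cont_sub R g (fun=> g z)); [exact: cg|exact: cst_continuous].
  apply: (@cont_inv R (fun w => w - z) w wz0).
  apply: hol_cont; apply: (@holB R id (fun=> z)); [exact: hol_id|exact: hol_cst].
apply/cont_cdiscP => e e0; move/cont_cdiscP: cq => /(_ e e0)[d d0 H].
exists (Num.min d (cmod (w - z))); first by rewrite lt_min d0 cmod_gt0.
move=> x; rewrite lt_min => /andP[xd xw]; rewrite /slope (negbTE wz).
case: eqVneq xw => [->|xz _]; first by rewrite cmodB ltxx.
exact: H.
Qed.

(** Newton interpolation at fresh nodes. Dividing f - f(x) by w - x, for a node x
    outside the exceptional set, lowers the exponent by 1 and makes x a point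
    of mere continuity; when the exponent is used up, the quotient tends to 0
    along large circles and vanishes by the maximum principle. The bound is
    written as |f| r <= B r^n so that n = 0 is the vanishing case. *)
Lemma poly_of_growth n f (S : seq C) (B : R) :
  (forall z, {for z, continuous f}) -> (forall z, z \notin S -> hol f z) ->
  (forall b : R, exists2 r, b < r & forall z, cmod z = r -> cmod (f z) * r <= B * r ^+ n) ->
  exists p : {poly R[i]}, forall z, f z = p.[z].
Proof.
elim: n f S B => [|n IH] f S B cf hf growth.
  exists 0 => z; rewrite horner0; apply/eqP; rewrite -cmod_eq0 eq_le cmod_ge0 andbT.
  apply/ler_addgt0Pl => m m0; rewrite addr0.
  have [r rb Hr] := growth (Num.max (cmod z) (B / m)).
  move: rb; rewrite gt_max => /andP[zr Br].
  have r0 : 0 < r by apply: le_lt_trans zr; exact: cmod_ge0.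
  apply: (@max_principle R [set w : C | cmod (w - 0) <= r]); last by rewrite /= subr0 ltW.
  - exact: closed_disc_compact.
  - by move=> w _; exact: cf.
  move=> w /=; rewrite subr0 le_eqVlt => /predU1P[wr|wr].
    left; have := Hr w wr; rewrite expr0 mulr1 -ler_pdivlMr// => /le_trans; apply.
    by rewrite ler_pdivrMr// mulrC -ler_pdivrMr// ltW.
  right; have [rho rho0 H] := punctured_disc_avoiding_seq S w.
  exists (Num.min rho (r - cmod w)); first by rewrite lt_min rho0 subr_gt0.
  move=> y; rewrite lt_min => /andP[y1 y2]; split.
    rewrite /= subr0; have := cmodD (y - w) w; rewrite subrK; lra.
  by move=> yw; apply: hf; apply: H; rewrite y1 cmod_gt0 subr_eq0 yw.
have [x xS] := fresh_point S.
have /holP[l fl] := hf x xS.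
have [||b|p Hp] := IH (slope f x l) (x :: S) (2 * (`|B| + cmod (f x))).
- move=> z; have [->|zx] := eqVneq z x; first exact: slope_cont.
  exact: slope_cont_ne.
- move=> z; rewrite inE negb_or => /andP[zx zS]; apply: slope_hol => //; exact: hf.
- have [r rb Hr] := growth (Num.max b (Num.max 1 (2 * cmod x))).
  move: rb; rewrite !gt_max => /andP[br /andP[r1 rx]]; exists r => // z zr.
  have r0 : 0 < r by lra.
  have zx : r / 2 <= cmod (z - x).
    have := cmodD (z - x) x; rewrite subrK zr; lra.
  have zx0 : 0 < cmod (z - x) by lra.
  have znx : z != x by rewrite -subr_eq0 -cmod_gt0.
  rewrite /slope (negbTE znx) cmodM cmodV mulrAC ler_pdivrMr//.
  have fz : cmod (f z) <= `|B| * r ^+ n.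
    rewrite -(ler_pM2r r0); apply: le_trans (Hr z zr) _.
    by rewrite exprSr mulrA ler_pM2r// ler_wpM2r ?exprn_ge0 ?ler_norm// ltW.
  have fx : cmod (f x) <= cmod (f x) * r ^+ n.
    by rewrite ler_peMr ?cmod_ge0// exprn_ege1// ltW.
  have h1 : cmod (f z - f x) <= (`|B| + cmod (f x)) * r ^+ n.
    apply: le_trans (cmodD _ _) _; rewrite cmodN mulrDl; exact: lerD.
  have h2 : cmod (f z - f x) * r <= (`|B| + cmod (f x)) * r ^+ n * (2 * cmod (z - x)).
    by rewrite ler_pM ?cmod_ge0 ?(ltW r0)//; lra.
  lra.
exists ((f x)%:P + p * ('X - x%:P)) => z.
by rewrite hornerD hornerC hornerM hornerXsubC -Hp -slopeE.
Qed.

Lemma transcendental_growth f n : (forall z, hol f z) ->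
  (~ exists p : {poly R[i]}, forall z, f z = p.[z]) ->
  exists r0 : R, forall r, r0 <= r -> r ^+ n < max_modulus f r.
Proof.
move=> hf np; apply: contrapT => H; apply: np.
apply: (@poly_of_growth n.+1 f [::] 1).
- by move=> z; exact: hol_cont.
- by move=> z _; exact: hf.
move=> b; apply: contrapT => Hb; apply: H; exists (Num.max 0 (b + 1)) => r.
rewrite ge_max => /andP[r0 br]; rewrite ltNge; apply/negP => Mr; apply: Hb.
exists r; first lra.
move=> z zr; rewrite mul1r exprSr ler_wpM2r//; apply: le_trans Mr.
by have [Hz _] := max_modulusP hf r0; exact: Hz.
Qed.

End Entire.

Section Hadamard.
Local Open Scope complex_scope.
Variable R : realType.
Local Notation C := (Cplx R).
Implicit Types (z w : C) (r e t : R) (g k h f : C -> C).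

Lemma ler_Xn_ln (a b : R) (p q : nat) : 0 < a -> 0 < b ->
  (a ^+ q <= b ^+ p) = (q%:R * ln a <= p%:R * ln b).
Proof.
move=> a0 b0; rewrite -ler_ln ?posrE ?exprn_gt0//.
by rewrite -!powR_mulrn ?(ltW a0) ?(ltW b0)// !ln_powR.
Qed.

(** A consequence of Hadamard's three circles theorem. Put M(r) = r^al. If
    M(r^c) < M(r)^c then a rational p/q slightly below al makes
    f^q / z^p of modulus at most 1 on the circles of radii 2 and r^c, and greater
    than 1 somewhere on the circle of radius r; this contradicts the maximum
    principle. On the circle of radius 2 one needs M(2) < 2^al, which holds as
    soon as r is large. *)
Lemma max_modulus_powR f : (forall z, hol f z) ->
  (~ exists p : {poly R[i]}, forall z, f z = p.[z]) ->
  exists r0 : R, forall r c, r0 <= r -> 1 <= c ->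
    max_modulus f r `^ c <= max_modulus f (r `^ c).
Proof.
move=> hf np.
have M20 := max_modulus_ge0 hf (ler0n R 2).
have [k Hk] : exists k : nat, max_modulus f 2 < 2 ^+ k.
  exists (Num.bound (max_modulus f 2)); apply: lt_trans (archi_boundP M20) _.
  by rewrite -natrX ltr_nat ltn_expl.
have [r1 H1] := transcendental_growth k hf np.
exists (Num.max r1 3) => r c; rewrite ge_max => /andP[rr1 r3].
rewrite le_eqVlt => /predU1P[<-|c1].
  by rewrite !powRr1//; [lra|apply: max_modulus_ge0 => //; lra].
rewrite leNgt; apply/negP; set s := r `^ c => Ms.
have r0 : 0 < r by lra.
have lr0 : 0 < ln r by rewrite ln_gt0//; lra.
have lsE : ln s = c * ln r by rewrite ln_powR.
have s0 : 0 < s by rewrite powR_gt0.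
have lrs : ln r < ln s by rewrite lsE ltr_pMl.
have rs : r < s by rewrite -ltr_ln ?posrE.
have ls0 : 0 < ln s by exact: lt_trans lrs.
have Mr := H1 _ rr1.
have Mr0 : 0 < max_modulus f r by apply: le_lt_trans Mr; rewrite exprn_ge0// ltW.
have Ms0 : 0 < max_modulus f s.
  by apply: lt_le_trans Mr0 _; apply: max_modulus_mono => //; exact: ltW.
pose al := ln (max_modulus f r) / ln r.
(* p/q will be taken strictly between be and al *)
pose be := Num.max k%:R (ln (max_modulus f s) / ln s).
have kal : k%:R < al.
  rewrite /al ltr_pdivlMr//; move: Mr.
  by rewrite -ltr_ln ?posrE ?exprn_gt0// -powR_mulrn ?ln_powR// ltW.
have beal : be < al.
  rewrite gt_max kal ltr_pdivrMr//=.
  have -> : al * ln s = c * ln (max_modulus f r).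
    by rewrite lsE /al; field; rewrite gt_eqF.
  by rewrite -ln_powR ltr_ln ?posrE// powR_gt0.
have be0 : 0 <= be by rewrite le_max ler0n.
have kbe : k%:R <= be by rewrite le_max lexx.
have sbe : ln (max_modulus f s) <= be * ln s.
  by rewrite -ler_pdivrMr// le_max lexx orbT.
have [q q0 Hq] : exists2 q : nat, (0 < q)%N & 1 < q%:R * (al - be).
  have d0 : 0 < al - be by rewrite subr_gt0.
  exists (Num.bound (al - be)^-1).+1 => //.
  rewrite -ltr_pdivrMr// div1r; apply: lt_trans (archi_boundP _) _; first by rewrite invr_ge0 ltW.
  by rewrite ltr_nat.
pose p := (Num.truncn (q%:R * be)).+1.
have qbe0 : 0 <= q%:R * be by rewrite mulr_ge0.
have /andP[p1 p2] := truncn_itv qbe0.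
have pq1 : q%:R * be < p%:R by exact: p2.
have pq2 : p%:R < q%:R * al.
  have -> : p%:R = (Num.truncn (q%:R * be))%:R + 1 :> R by rewrite /p -natr1.
  by move: Hq; rewrite mulrBr; lra.
pose G z := f z ^+ q / z ^+ p.
have GE z : cmod (G z) = cmod (f z) ^+ q / cmod z ^+ p.
  by rewrite /G cmodM cmodV !cmodX.
have hG z : z != 0 -> hol G z.
  move=> z0; apply: (@holM R (fun z => f z ^+ q) (fun z => (z ^+ p)^-1)).
    exact: (@holX R f).
  apply: (@holV R (fun z => z ^+ p)); first by rewrite expf_neq0.
  by apply: (@holX R id); exact: hol_id.
pose K := [set z : C | 2 <= cmod z <= s].
have K0 z : K z -> z != 0 by move=> /andP[z2 _]; rewrite -cmod_gt0; lra.
have [Hle [zr zr1 zr2]] := max_modulusP hf (ltW r0).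
have Kzr : K zr by apply/andP; rewrite zr1; split; [lra|exact: ltW].
have := @max_principle R K G 1 (@annulus_compact R 2 s) _ _ zr Kzr.
rewrite GE zr2 zr1 ler_pdivrMr ?exprn_gt0// mul1r ler_Xn_ln// => HH.
have {HH} : q%:R * ln (max_modulus f r) <= p%:R * ln r.
  apply: HH => z Kz; first by apply: hol_cont; apply: hG; exact: K0.
  have z0 : 0 < cmod z by rewrite cmod_gt0 K0.
  have /andP[z2 zs] := Kz.
  have fz : cmod (f z) <= max_modulus f (cmod z) by apply: max_modulus_disc.
  have qfz : cmod (f z) ^+ q <= max_modulus f (cmod z) ^+ q.
    by rewrite lerXn2r ?nnegrE ?cmod_ge0//; apply: le_trans fz; exact: cmod_ge0.
  have [z2'|z2'] := eqVneq (cmod z) 2.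
    left; rewrite GE ler_pdivrMr ?exprn_gt0// mul1r; apply: le_trans qfz _.
    rewrite z2'; apply: (@le_trans _ _ ((2 ^+ k) ^+ q)).
      by rewrite lerXn2r ?nnegrE ?exprn_ge0// ltW.
    rewrite -exprM ler_weXn2l//; first lra.
    have : (k * q)%N%:R < p%:R :> R.
      by rewrite natrM mulrC; apply: le_lt_trans pq1; rewrite ler_wpM2l.
    by rewrite ltr_nat => /ltnW.
  have [zs'|zs'] := eqVneq (cmod z) s.
    left; rewrite GE ler_pdivrMr ?exprn_gt0// mul1r; apply: le_trans qfz _.
    rewrite zs' ler_Xn_ln//; apply: le_trans (_ : q%:R * (be * ln s) <= _).
      by rewrite ler_wpM2l.
    by rewrite mulrA ler_wpM2r// ltW.
  right; exists (Num.min (cmod z - 2) (s - cmod z)).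
    by rewrite lt_min !subr_gt0 !lt_neqAle z2 zs zs' eq_sym z2'.
  move=> w; rewrite lt_min => /andP[w1 w2].
  have Kw : K w.
    have h1 := cmodD (w - z) z; have h2 := cmodD (z - w) w.
    rewrite !subrK in h1 h2; rewrite [cmod (z - w)]cmodB in h2.
    by apply/andP; split; lra.
  by split=> // _; apply: hG; exact: K0.
apply/negP; rewrite -ltNge -ltr_pdivlMr//.
by rewrite -mulrA.
Qed.

End Hadamard.

(** * Normality and connectedness *)

Section Normal.
Local Open Scope complex_scope.
Variable R : realType.
Local Notation C := (Cplx R).
Implicit Types (z w : C) (r e t : R) (g k h f : C -> C).

Lemma hol_iter f n z : (forall z, hol f z) -> hol (iter n f) z.
Proof.
move=> hf; elim: n => [|n IH]; first exact: hol_id.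
by apply: (@hol_comp R (iter n f) f).
Qed.

(** A coordinate of the stereographic projection: 0 at infinity, and Lipschitz
    for the chordal distance. It makes the triangle inequality of that distance
    unnecessary. *)
Definition height (x : sphere R) : R :=
  match x with Some z => (Num.sqrt (1 + cmod z ^+ 2))^-1 | None => 0 end.

Lemma sqrt1D_ge (z : C) : 1 <= Num.sqrt (1 + cmod z ^+ 2) /\ cmod z <= Num.sqrt (1 + cmod z ^+ 2).
Proof.
have h := sqr_ge0 (cmod z); split.
  by rewrite -[leLHS]sqrtr1 ler_wsqrtr//; lra.
by rewrite -[leLHS]ger0_norm ?cmod_ge0// -sqrtr_sqr ler_wsqrtr//; lra.
Qed.

Lemma height_lip (z : C) (y : sphere R) : `|height (Some z) - height y| <= chordal (Some z) y.
Proof.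
have [a1 _] := sqrt1D_ge z; case: y => [w|] /=.
  have [b1 _] := sqrt1D_ge w.
  set a := Num.sqrt _ in a1 *; set b := Num.sqrt (1 + cmod w ^+ 2) in b1 *.
  have a0 : 0 < a by lra.
  have b0 : 0 < b by lra.
  have -> : a^-1 - b^-1 = (b - a) / (a * b) by field; rewrite !gt_eqF.
  rewrite normrM normrV ?unitfE ?mulf_neq0 ?gt_eqF// (gtr0_norm (mulr_gt0 a0 b0)).
  rewrite ler_pM2r ?invr_gt0 ?mulr_gt0//.
  have ab : `|b - a| <= `|cmod w - cmod z|.
    have e1 : (b - a) * (b + a) = (cmod w - cmod z) * (cmod w + cmod z).
      have -> : (b - a) * (b + a) = b ^+ 2 - a ^+ 2 by ring.
      by rewrite /a /b !sqr_sqrtr ?addr_ge0 ?sqr_ge0//; ring.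
    have [_ az] := sqrt1D_ge z; have [_ bw] := sqrt1D_ge w.
    rewrite -/a -/b in az bw.
    have ba0 : 0 < b + a by rewrite addr_gt0.
    rewrite -(ler_pM2r ba0) -{1}(gtr0_norm ba0) -normrM e1 normrM.
    apply: ler_wpM2l => //; rewrite ger0_norm ?addr_ge0 ?cmod_ge0//; exact: lerD.
  apply: le_trans ab _; apply: le_trans (ler_cmodB _ _) _.
  by rewrite cmodB; have := cmod_ge0 (z - w); lra.
rewrite subr0 ger0_norm ?invr_ge0; last by lra.
by rewrite ler_peMl ?invr_ge0; lra.
Qed.

Lemma homo_ge (phi : nat -> nat) : {homo phi : m n / (m < n)%N} -> forall n, (n <= phi n)%N.
Proof.
move=> hphi; elim=> [//|n IH]; apply: leq_ltn_trans IH _; exact: hphi.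
Qed.

(** Equicontinuity for the chordal distance, in the only form that is used.
    Otherwise some sequence of iterates takes, at points converging to z, both
    values in the unit disc and values tending to infinity; along a convergent
    subsequence a single iterate would then separate nearby points by a definite
    height. *)
Lemma Fatou_dichotomy f z : (forall z, hol f z) -> Fatou f z ->
  exists rho A : R, [/\ 0 < rho, forall w, cmod (w - z) < rho -> Fatou f w &
    forall n, (0 < n)%N ->
      (forall w, cmod (w - z) < rho -> 1 < cmod (iter n f w)) \/
      (forall w, cmod (w - z) < rho -> cmod (iter n f w) <= A)].
Proof.
move=> hf [U [oU Uz] nU].
have /nbhs_cdisc[e e0 He] : nbhs z U by apply: open_nbhs_nbhs; split.
have UF w : U w -> Fatou f w by move=> Uw; exists U.
apply: contrapT => H.
have : forall m : nat, exists n, (0 < n)%N /\ exists y y' : C,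
    [/\ cmod (y - z) < m.+1%:R^-1, cmod (y' - z) < m.+1%:R^-1,
      cmod (iter n f y) <= 1 & m%:R < cmod (iter n f y')].
  move=> m; apply: contrapT => Hm; apply: H.
  exists (Num.min e m.+1%:R^-1), m%:R; split.
  - by rewrite lt_min e0 invr_gt0 ltr0Sn.
  - by move=> w; rewrite lt_min => /andP[we _]; apply: UF; exact: He.
  move=> n n0; have [|/existsNP[y /not_implyP[yr /negP]]] :=
    pselect (forall w, cmod (w - z) < Num.min e m.+1%:R^-1 -> 1 < cmod (iter n f w)); first by left.
  rewrite -leNgt => y1; right => y' y'r; rewrite leNgt; apply/negP => y'm.
  apply: Hm; exists n; split => //; exists y, y'.
  by move: yr y'r; rewrite !lt_min => /andP[_ ->] /andP[_ ->].
move=> /choice[nn Hnn].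
have [|phi [hphi [h Hh]]] := nU (fun m => iter (nn m) f).
  by move=> m; exists (nn m) => //=; have [] := Hnn m.
have e20 : 0 < e / 2 by lra.
have KU : [set w : C | cmod (w - z) <= e / 2] `<=` U by move=> w /= we; apply: He; lra.
have eps0 : 0 < (20^-1 : R) by rewrite invr_gt0.
have [N _ HN] := Hh _ (@closed_disc_compact R z (e / 2)) KU _ eps0.
pose G := iter (nn (phi N)) f.
have /cont_cdiscP cG : {for z, continuous G} by apply: hol_cont; exact: hol_iter.
have sG : exists2 d, 0 < d & forall w, cmod (w - z) < d ->
    `|height (Some (G w)) - height (Some (G z))| < 20^-1.
  have g20 : 0 < (40^-1 : R) by rewrite invr_gt0.
  have [d d0 Hd] := cG _ g20; exists d => // w /Hd wd.
  apply: le_lt_trans (height_lip _ _) _ => /=.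
  have [a1 _] := sqrt1D_ge (G w); have [b1 _] := sqrt1D_ge (G z).
  rewrite ltr_pdivrMr ?mulr_gt0//; try lra.
  have : 1 <= Num.sqrt (1 + cmod (G w) ^+ 2) * Num.sqrt (1 + cmod (G z) ^+ 2).
    by rewrite -[leLHS]mulr1 ler_pM.
  lra.
have [d d0 Hd] := sG.
pose md := Num.min d (e / 2).
have md0 : 0 < md by rewrite lt_min d0.
pose k := (N + (Num.bound md^-1 + 10))%N.
have Nk : (N <= k)%N by rewrite leq_addr.
have pk := homo_ge hphi k.
have km : (Num.bound md^-1 <= phi k)%N.
  by apply: leq_trans pk; rewrite /k addnCA leq_addr.
have k10 : (10 <= phi k)%N by apply: leq_trans pk; rewrite /k addnA leq_addl.
have small : (phi k).+1%:R^-1 < md.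
  rewrite invf_plt ?posrE//; apply: lt_trans (archi_boundP _) _; first by rewrite invr_ge0 ltW.
  by rewrite ltr_nat ltnS.
have [_ [y [y' [yz y'z gy gy']]]] := Hnn (phi k).
have cmp w : cmod (w - z) < (phi k).+1%:R^-1 ->
    `|height (Some (iter (nn (phi k)) f w)) - height (Some (G z))| < 3 / 20.
  move=> /lt_trans/(_ small); rewrite lt_min => /andP[wd we].
  have we' : cmod (w - z) <= e / 2 by lra.
  have h1 := le_lt_trans (height_lip _ _) (HN k Nk w we').
  have h2 := le_lt_trans (height_lip _ _) (HN N (leqnn N) w we').
  have h3 := Hd w wd.
  rewrite /= -/G in h1 h2 h3 *.
  move: h1 h2 h3; rewrite !ltr_norml => /andP[? ?] /andP[? ?] /andP[? ?].
  apply/andP; split; lra.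
have c1 := cmp _ yz; have c2 := cmp _ y'z.
have h1 : 2^-1 <= height (Some (iter (nn (phi k)) f y)).
  rewrite /height lef_pV2 ?posrE//; last by have [] := sqrt1D_ge (iter (nn (phi k)) f y); lra.
  rewrite -[leRHS]ger0_norm// -sqrtr_sqr ler_wsqrtr//.
  have : cmod (iter (nn (phi k)) f y) ^+ 2 <= 1 by rewrite expr_le1 ?cmod_ge0.
  lra.
have h2 : height (Some (iter (nn (phi k)) f y')) <= 10^-1.
  have [h2 h3] := sqrt1D_ge (iter (nn (phi k)) f y').
  rewrite /height lef_pV2 ?posrE//; last by lra.
  apply: le_trans h3; apply: le_trans (ltW gy').
  by rewrite ler_nat.
move: c1 c2 h1 h2; rewrite !ltr_norml.
move: (height _) (height _) (height _) => s1 s2 s3 /andP[? ?] /andP[? ?]; lra.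
Qed.

(** The points joined to x by a suitable connected set form a set that is open and
    relatively closed in U: a disc around any of its limit points can be added to
    one of the connected sets. *)
Lemma connected_by_local_property (P : set C -> Prop) (U : set C) : connected U ->
  (forall x, U x -> exists2 rho, 0 < rho &
     [set w : C | cmod (w - x) < rho] `<=` U /\ P [set w : C | cmod (w - x) < rho]) ->
  (forall A B, A `&` B !=set0 -> P A -> P B -> P (A `|` B)) ->
  forall x y, U x -> U y -> exists K, [/\ connected K, K `<=` U, K x, K y & P K].
Proof.
move=> cU loc un x y Ux Uy.
pose V := [set y | exists K, [/\ connected K, K `<=` U, K x, K y & P K]].
pose D a (r : R) := [set w : C | cmod (w - a) < r].
have Dc a r : 0 < r -> D a r a by move=> r0; rewrite /D /= subrr cmod0.
have ext a b rho : 0 < rho -> D a rho `<=` U -> P (D a rho) -> D a rho b -> V b ->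
    D a rho `<=` V.
  move=> rho0 DU PD Db [K [cK KU Kx Kb PK]] w Dw.
  exists (K `|` D a rho); split.
  - by apply: connectedU => //; [exists b|exact: disc_connected].
  - by move=> v [/KU|/DU].
  - by left.
  - by right.
  - by apply: un => //; exists b.
have VU : V `<=` U by move=> v [K [_ KU _ Kv _]]; exact: KU.
have Vloc a : V a -> exists2 rho, 0 < rho & D a rho `<=` V.
  move=> Va; have [rho rho0 [DU PD]] := loc a (VU _ Va).
  by exists rho => //; apply: (ext a a) => //; exact: Dc.
have Vx : V x.
  have [rho rho0 [DU PD]] := loc x Ux.
  exists (D x rho); split=> //; [exact: disc_connected|exact: Dc|exact: Dc].
have VE : V = U.
  apply: cU.
  - by exists x.
  - exists V; last by rewrite setIidr.
    rewrite openE => a /Vloc[rho rho0 DV]; apply/nbhs_cdisc; by exists rho.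
  - exists (closure V); first exact: closed_closure.
    rewrite eqEsubset; split=> a; first by move=> Va; split; [exact: VU|exact: subset_closure].
    move=> [Ua clVa]; have [rho rho0 [DU PD]] := loc a Ua.
    have [b [Vb Db]] : V `&` D a rho !=set0.
      by apply: clVa; apply/nbhs_cdisc; exists rho.
    exact: (ext a b rho rho0 DU PD Db Vb a (Dc _ _ rho0)).
by have : V y by rewrite VE.
Qed.

End Normal.

(** * Growth of the iterates on connected sets *)

Section Growth.
Local Open Scope complex_scope.
Variable R : realType.
Local Notation C := (Cplx R).
Implicit Types (z w : C) (r e t : R) (g h f : C -> C).

Lemma summable_tail (a : nat -> R) : cvgn (series a) -> exists N0, forall N k, (N0 <= N)%N ->
  \sum_(N <= j < N + k) a j <= 2^-1.
Proof.
move=> /cvg_ex[l /cvgrPdist_lt Hl].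
have e0 : 0 < (4^-1 : R) by rewrite invr_gt0.
have [N0 _ H] := Hl _ e0; exists N0 => N k N0N.
have := H (N + k)%N (leq_trans N0N (leq_addr _ _)); have := H N N0N.
rewrite /series /= (@big_cat_nat _ _ _ N 0 (N + k)%N) ?leq_addr//=.
by rewrite !ltr_norml => /andP[? ?] /andP[? ?]; lra.
Qed.

(** Let R_k be the terms from N on, and c_k = 2 (1 - a_N - ... - a_(N+k-1)), so that
    1 <= c_k <= 2. By induction on k the image of K under the k-th iterate meets
    |w| <= R_k, by the maximum principle, and |w| >= R_k^(L c_k). In the step put
    r = R_k^(c_k), which lies between R_k and R_(k+1) since M(R_k) > R_k^2. The
    hypothesis gives t between r and r^L; by connectedness the image meets
    |w| = t, and there |f| >= m(t) >= M(r)^(L (1 - a)), where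
    M(r) >= R_(k+1)^(c_k) and c_k (1 - a) >= c_(k+1). *)
Lemma orbit_growth f (Rs a : nat -> R) (L : R) :
  (forall z, hol f z) ->
  (~ exists p : {poly R[i]}, forall z, f z = p.[z]) ->
  (forall n, Rs n.+1 = max_modulus f (Rs n)) ->
  Rs n @[n --> \oo] --> +oo ->
  1 < L -> (forall n, 0 < a n) ->
  (forall (n : nat) (r : R), Rs n <= r < Rs n.+1 ->
              exists2 t : R, r < t < r `^ L &
                (lne (min_modulus f t)%:E / lne (max_modulus f r)%:E
                   >= (L * (1 - a n))%:E)%E) ->
  cvgn (series a) ->
  exists N0, forall N, (N0 <= N)%N -> 3 <= Rs N /\
    forall (K : set C) z0 z1, connected K -> K z0 -> K z1 ->
      cmod z0 <= Rs N -> Rs N `^ (2 * L) <= cmod z1 ->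
      forall k, exists2 z, K z & L * ln (Rs (N + k)%N) <= ln (cmod (iter k f z)).
Proof.
move=> hf np hRS hRoo L1 a0 hL acv.
have [r1 H1] := max_modulus_powR hf np.
have [r2 H2] := transcendental_growth 2 hf np.
have [N1 HN1] := summable_tail acv.
have /cvgryPge/(_ (Num.max 3 (Num.max r1 r2)))[N2 _ HN2] := hRoo.
have big N : (N2 <= N)%N -> [/\ 3 <= Rs N, r1 <= Rs N & r2 <= Rs N].
  by move=> /HN2 /=; rewrite !ge_max => /andP[? /andP[]].
exists (maxn N1 N2) => N; rewrite geq_max => /andP[N1N N2N].
have [N3 _ _] := big N N2N; split=> // K z0 z1 cK Kz0 Kz1 z0N z1N.
have bigk k := big (N + k)%N (leq_trans N2N (leq_addr _ _)).
have z0k k : cmod (iter k f z0) <= Rs (N + k)%N.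
  elim: k => [|k IH]; first by rewrite addn0.
  by rewrite iterS addnS hRS; apply: max_modulus_disc.
pose S k := \sum_(N <= j < N + k) a j.
have S0 k : 0 <= S k by apply: sumr_ge0 => j _; exact: ltW.
have Sh k : S k <= 2^-1 by exact: HN1.
have SS k : S k.+1 = S k + a (N + k)%N by rewrite /S addnS big_nat_recr ?leq_addr.
pose c k := 2 * (1 - S k).
have c1 k : 1 <= c k by rewrite /c; have := Sh k; lra.
have c2 k : c k <= 2 by rewrite /c; have := S0 k; lra.
have main k : exists2 z, K z & L * (c k * ln (Rs (N + k)%N)) <= ln (cmod (iter k f z)).
  elim: k => [|k [z Kz IH]].
    exists z1 => //; rewrite addn0 /=.
    have -> : c 0%N = 2 by rewrite /c /S addn0 big_geq// subr0 mulr1.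
    have RN0 : 0 < Rs N by lra.
    have p0 : 0 < Rs N `^ (2 * L) by rewrite powR_gt0.
    rewrite mulrA [L * 2]mulrC -ln_powR ler_ln ?posrE//.
    exact: lt_le_trans z1N.
  have [b3 br1 br2] := bigk k.
  set Rk := Rs (N + k)%N in IH b3 br1 br2.
  have Rk0 : 0 < Rk by lra.
  have lRk : 0 < ln Rk by rewrite ln_gt0//; lra.
  pose r := Rk `^ c k.
  have r0 : 0 < r by rewrite powR_gt0.
  have lnr : ln r = c k * ln Rk by rewrite ln_powR.
  have rI : Rs (N + k)%N <= r < Rs (N + k).+1.
    apply/andP; split; first by rewrite -/Rk /r le1r_powR//; lra.
    rewrite hRS -/Rk; apply: le_lt_trans (H2 _ br2).
    by rewrite -powR_mulrn ?(ltW Rk0)// ler_powR//; lra.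
  have [t /andP[rt tr] Ht] := hL _ _ rI.
  have t0 : 0 < t by lra.
  have fz0 : 0 < cmod (iter k f z).
    rewrite lt_neqAle cmod_ge0 andbT eq_sym; apply/negP => /eqP E.
    move: IH; rewrite E (ln0 (lexx 0)) leNgt => /negP; apply.
    have ck0 : 0 < c k by have := c1 k; lra.
    by apply: mulr_gt0; [lra|exact: mulr_gt0].
  have ct w : K w -> {for w, continuous (fun w => cmod (iter k f w))}.
    by move=> _; apply: cmod_comp_cont; apply: hol_cont; exact: hol_iter.
  have [|z' Kz' z't] := @connected_IVT R K _ z0 z t cK ct Kz0 Kz.
    apply/andP; split.
      apply: ltW; apply: le_lt_trans (z0k k) _; apply: le_lt_trans rt.
      by have /andP[] := rI.
    apply: ltW; apply: lt_le_trans tr _.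
    by rewrite -ler_ln ?posrE ?powR_gt0// ln_powR lnr.
  exists z' => //; rewrite addnS hRS -/Rk iterS.
  have mt : min_modulus f t <= cmod (f (iter k f z')) by rewrite -z't; exact: min_modulus_le.
  have Mk1 : 1 < max_modulus f Rk.
    apply: le_lt_trans (H2 _ br2); rewrite exprn_ege1//; lra.
  have Mr : max_modulus f Rk `^ c k <= max_modulus f r by exact: H1.
  have lMk : 0 < ln (max_modulus f Rk) by rewrite ln_gt0.
  have lMr : c k * ln (max_modulus f Rk) <= ln (max_modulus f r).
    rewrite -ln_powR ler_ln ?posrE ?powR_gt0//; try lra.
    by apply: lt_le_trans Mr; rewrite powR_gt0; lra.
  have lMr0 : 0 < ln (max_modulus f r).
    by apply: lt_le_trans lMr; apply: mulr_gt0 => //; have := c1 k; lra.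
  have Mr0 : 0 < max_modulus f r by apply: lt_le_trans Mr; rewrite powR_gt0; lra.
  have ak : a (N + k)%N <= 2^-1 by have := Sh k.+1; rewrite SS; have := S0 k; lra.
  have ak0 := a0 (N + k)%N.
  have [m0 lm] : 0 < min_modulus f t /\
      L * (1 - a (N + k)%N) * ln (max_modulus f r) <= ln (min_modulus f t).
    move: Ht; rewrite (lne_EFin Mr0).
    have [m0|m0] := leP (min_modulus f t) 0.
      rewrite le0_lneNy ?lee_fin// inver gt_eqF// gt0_mulNye ?lte_fin ?invr_gt0//.
    by rewrite (lne_EFin m0) inver gt_eqF// -EFinM lee_fin ler_pdivlMr.
  apply: le_trans (_ : ln (min_modulus f t) <= _); last first.
    by rewrite ler_ln ?posrE//; exact: lt_le_trans mt.
  apply: le_trans lm.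
  apply: le_trans (_ : L * (1 - a (N + k)%N) * (c k * ln (max_modulus f Rk)) <= _); last first.
    by rewrite ler_pM2l// mulr_gt0//; lra.
  rewrite -!mulrA ler_pM2l ?mulrA; last lra.
  rewrite ler_pM2r//.
  rewrite /c SS; have : 0 <= a (N + k)%N * S k by rewrite mulr_ge0// ltW.
  lra.
move=> k; have [z Kz Hz] := main k; exists z => //; apply: le_trans Hz.
have [b3 _ _] := bigk k.
have lR : 0 < ln (Rs (N + k)%N) by rewrite ln_gt0//; lra.
by rewrite ler_pM2l; [rewrite ler_peMl// ltW|lra].
Qed.

End Growth.

(** * Orbits in a Fatou component *)

Section Final.
Local Open Scope complex_scope.
Variable R : realType.
Local Notation C := (Cplx R).
Implicit Types (z w : C) (r e t : R) (f : C -> C).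

(** The logarithm of the modulus of the orbit, cut off at 1 so that bounded
    orbits are harmless and ratios make sense. *)
Definition log_orbit f n z : R := Num.max 1 (ln (cmod (iter n f z))).

Definition comparable_orders f (K : set C) := exists2 c : R, 1 <= c &
  forall n z w, (0 < n)%N -> K z -> K w -> log_orbit f n z <= c * log_orbit f n w.

Definition asymptotic_orders f (K : set C) := forall e : R, 0 < e ->
  exists n0, forall n z w, (n0 <= n)%N -> K z -> K w -> log_orbit f n z <= (1 + e) * log_orbit f n w.

Lemma log_orbit_ge1 f n z : 1 <= log_orbit f n z.
Proof. by rewrite le_max lexx. Qed.

Lemma log_orbit_ge_ln f n z : ln (cmod (iter n f z)) <= log_orbit f n z.
Proof. by rewrite le_max lexx orbT. Qed.

Lemma log_orbit_le f n z (b : R) : 1 <= b -> ln (cmod (iter n f z)) <= b -> log_orbit f n z <= b.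
Proof. by move=> b1 h; rewrite ge_max b1. Qed.

Lemma comparable_ordersU f (A B : set C) : A `&` B !=set0 ->
  comparable_orders f A -> comparable_orders f B -> comparable_orders f (A `|` B).
Proof.
move=> [p [Ap Bp]] [c c1 Hc] [d d1 Hd]; exists (c * d); first by rewrite -[leLHS]mulr1 ler_pM.
have c0 : 0 < c by lra.
have d0 : 0 < d by lra.
move=> n z w n0 zAB wAB.
have lw : 0 <= log_orbit f n w by apply: le_trans (log_orbit_ge1 f n w).
have cw : c * log_orbit f n w <= c * d * log_orbit f n w by rewrite -mulrA ler_pM2l// ler_peMl.
have dw : d * log_orbit f n w <= c * d * log_orbit f n w by rewrite [c * d]mulrC -mulrA ler_pM2l// ler_peMl.
case: zAB => hz; case: wAB => hw.
- exact: le_trans (Hc _ _ _ n0 hz hw) cw.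
- by apply: le_trans (Hc _ _ _ n0 hz Ap) _; rewrite -mulrA ler_pM2l//; exact: Hd.
- apply: le_trans (Hd _ _ _ n0 hz Bp) _.
  by rewrite [c * d]mulrC -mulrA ler_pM2l//; exact: Hc.
- exact: le_trans (Hd _ _ _ n0 hz hw) dw.
Qed.

Lemma asymptotic_ordersU f (A B : set C) : A `&` B !=set0 ->
  asymptotic_orders f A -> asymptotic_orders f B -> asymptotic_orders f (A `|` B).
Proof.
move=> [p [Ap Bp]] hA hB e e0; pose d := Num.min 1 (e / 3).
have d0 : 0 < d by rewrite lt_min ltr01 divr_gt0.
have d1 : d <= 1 by rewrite ge_min lexx.
have d3 : 3 * d <= e by rewrite mulrC -ler_pdivlMr// ge_min lexx orbT.
have [n1 H1] := hA _ d0; have [n2 H2] := hB _ d0.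
have dd : (1 + d) * (1 + d) <= 1 + e.
  have : d * d <= d by rewrite ler_piMl// ltW.
  lra.
exists (maxn n1 n2) => n z w; rewrite geq_max => /andP[n1n n2n] zAB wAB.
have lw : 0 < log_orbit f n w by apply: lt_le_trans (log_orbit_ge1 f n w).
have one x : x <= (1 + d) * log_orbit f n w -> x <= (1 + e) * log_orbit f n w.
  by move=> /le_trans; apply; rewrite ler_pM2r//; lra.
have two x y : x <= (1 + d) * y -> y <= (1 + d) * log_orbit f n w -> x <= (1 + e) * log_orbit f n w.
  move=> h1 h2; apply: le_trans h1 _; apply: le_trans (_ : (1 + d) * ((1 + d) * log_orbit f n w) <= _).
    by rewrite ler_pM2l//; lra.
  by rewrite mulrA ler_pM2r.
case: zAB => hz; case: wAB => hw.
- by apply: one; exact: H1.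
- by apply: (two _ (log_orbit f n p)); [exact: H1|exact: H2].
- by apply: (two _ (log_orbit f n p)); [exact: H2|exact: H1].
- by apply: one; exact: H2.
Qed.

(** Where the iterate is large on the whole disc this is Harnack's inequality;
    where it is bounded, both values lie between 1 and a constant. *)
Lemma comparable_orders_local f x : (forall z, hol f z) -> Fatou f x ->
  exists2 rho, 0 < rho & (forall w, cmod (w - x) < rho -> Fatou f w) /\
    comparable_orders f [set w : C | cmod (w - x) < rho].
Proof.
move=> hf Fx; have [rho [A [rho0 HF HA]]] := Fatou_dichotomy hf Fx.
have K1 : 1 <= expR 2 :> R by rewrite -[leLHS]expR0 ler_expR.
have K0 : 0 < expR 2 :> R by exact: expR_gt0.
exists (rho / 8); first by rewrite divr_gt0.
split=> [w wx|]; first by apply: HF; lra.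
pose B := Num.max 1 (ln (Num.max 1 A)).
have B1 : 1 <= B by rewrite le_max lexx.
have KK : 1 <= expR 2 * expR 2 :> R by rewrite -[leLHS]mulr1 ler_pM.
exists (Num.max B (expR 2 * expR 2)); first by rewrite le_max B1.
move=> n z w n0 /= zx wx.
have lw1 := log_orbit_ge1 f n w.
have [big|bdd] := HA n n0; last first.
  have lz : log_orbit f n z <= B.
    rewrite ge_max B1 /=; have [->|z0] := eqVneq (cmod (iter n f z)) 0.
      by rewrite ln0//; lra.
    have z0' : 0 < cmod (iter n f z) by rewrite lt_neqAle eq_sym z0 cmod_ge0.
    rewrite le_max; apply/orP; right; rewrite ler_ln ?posrE//; last by rewrite lt_max ltr01.
    by rewrite le_max; apply/orP; right; apply: bdd; lra.
  apply: le_trans lz _; apply: le_trans (_ : B * log_orbit f n w <= _); first by rewrite ler_peMr//; lra.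
  by apply: ler_wpM2r; [lra|rewrite le_max lexx].
have har y : cmod (y - x) < rho / 8 ->
    ln (cmod (iter n f y)) <= expR 2 * ln (cmod (iter n f x)) /\
    ln (cmod (iter n f x)) <= expR 2 * ln (cmod (iter n f y)).
  move=> yx; apply: harnack_log_modulus rho0 _ big (ltW yx) => v _; exact: hol_iter.
have [h1 _] := har z zx; have [_ h2] := har w wx.
have lx1 := log_orbit_ge1 f n x.
have s1 : log_orbit f n z <= expR 2 * log_orbit f n x.
  apply: log_orbit_le; first by rewrite -[leLHS]mulr1 ler_pM.
  by apply: le_trans h1 _; rewrite ler_pM2l// log_orbit_ge_ln.
have s2 : log_orbit f n x <= expR 2 * log_orbit f n w.
  apply: log_orbit_le; first by rewrite -[leLHS]mulr1 ler_pM.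
  by apply: le_trans h2 _; rewrite ler_pM2l// log_orbit_ge_ln.
apply: le_trans s1 _; apply: le_trans (_ : expR 2 * expR 2 * log_orbit f n w <= _).
  by rewrite -mulrA ler_pM2l.
by apply: ler_wpM2r; [lra|rewrite le_max lexx orbT].
Qed.

Lemma bounded_of_cmod (A : set C) (b : R) : (forall z, A z -> cmod z <= b) -> bounded_set A.
Proof.
move=> H; exists b%:C; split.
  by rewrite complex_real.
move=> y; rewrite ltcE /= => /andP[/eqP y0 by_] z Az /=.
by rewrite cmodE lecE /= y0 eqxx /=; apply: le_trans (H z Az) (ltW by_).
Qed.

End Final.

(* Sequences indexed by {1, 2, ...} are shifted to start at 0: Rs n and a n are
   the (n+1)-st terms. [lne] is the extended logarithm, with lne 0 = -oo. *)
Theorem theorem1 (R : realType) (f : Cplx R -> Cplx R) (Rs : nat -> R)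
    (hf : transcendental_entire f)
    (hR1 : 0 < Rs 0%N)
    (hRS : forall n, Rs n.+1 = max_modulus f (Rs n))
    (hRoo : Rs n @[n --> \oo] --> +oo)
    (hL : exists (L : R) (a : nat -> R),
        [/\ 1 < L,
            forall n, 0 < a n,
            forall (n : nat) (r : R), Rs n <= r < Rs n.+1 ->
              exists2 t : R, r < t < r `^ L &
                (lne (min_modulus f t)%:E / lne (max_modulus f r)%:E
                   >= (L * (1 - a n))%:E)%E
          & cvgn (series a)]) :
  forall z : Cplx R, Fatou f z ->
    bounded_set (connected_component (Fatou f) z).
Proof.
move=> z Fz; case: hf => ent np; case: hL => L [a [L1 a0 hLL acv]].
have hf w : hol f w by split; exact: ent.
have [N0 HN0] := orbit_growth hf np hRS hRoo L1 a0 hLL acv.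
set U := connected_component (Fatou f) z.
have cU : connected U by exact: component_connected.
have Uz : U z by exact: connected_component_refl.
have UF : U `<=` Fatou f by exact: connected_component_sub.
apply: contrapT => nb.
have unb (b : R) : exists2 w, U w & b < cmod w.
  apply: contrapT => H; apply: nb; apply: (@bounded_of_cmod R U b) => w Uw.
  by rewrite leNgt; apply/negP => bw; apply: H; exists w.
have discU y rho : U y -> 0 < rho -> (forall w, cmod (w - y) < rho -> Fatou f w) ->
    [set w : Cplx R | cmod (w - y) < rho] `<=` U.
  move=> Uy rho0 HF w /= wy.
  apply: (@connected_component_trans _ _ y z w) => //.
  apply: (connected_component_max _ HF (@disc_connected R y rho)) => //.
  by rewrite /= subrr cmod0.
have [N N0N Nbig] : exists2 N, (N0 <= N)%N &
    forall k, cmod z <= Rs (N + k)%N /\ expR 1 <= Rs (N + k)%N.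
  have /cvgryPge/(_ (Num.max (cmod z) (expR 1)))[N1 _ HN1] := hRoo.
  exists (maxn N0 N1) => [|k]; first exact: leq_maxl.
  have /= := HN1 _ (leq_trans (leq_maxr N0 N1) (leq_addr k _)).
  by rewrite ge_max => /andP[].
have [zN _] := Nbig 0%N; rewrite addn0 in zN.
have [_ G] := HN0 N N0N.
have [z1 Uz1 /ltW z1N] := unb (Rs N `^ (2 * L)).
pose X k := ln (Rs (N + k)%N).
have R3 k : 3 <= Rs (N + k)%N.
  by have [] := HN0 (N + k)%N (leq_trans N0N (leq_addr _ _)).
have X0 k : 0 < X k by rewrite ln_gt0//; have := R3 k; lra.
have up k : cmod (iter k f z) <= Rs (N + k)%N.
  elim: k => [|k IH]; first by rewrite addn0.
  by rewrite iterS addnS hRS; apply: max_modulus_disc.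
have Xgrow (m : nat) : exists k0, forall k, (k0 <= k)%N -> m%:R * X k <= X k.+1.
  have [r0 Hr0] := transcendental_growth m hf np.
  have /cvgryPge/(_ r0)[k0 _ Hk0] := hRoo.
  exists k0 => k kk0; rewrite /X addnS hRS.
  have Rk0 : 0 < Rs (N + k)%N by have := R3 k; lra.
  have h := Hr0 _ (Hk0 _ (leq_trans kk0 (leq_addl N k))).
  have M0 := lt_trans (exprn_gt0 m Rk0) h.
  by rewrite -ln_powR powR_mulrn ?(ltW Rk0)// ler_ln ?posrE ?exprn_gt0// ltW.
(* M(r) exceeds every power of r, so the index cannot be shifted at the cost of
   a constant factor *)
have X_shift_unbounded (C : R) (p : nat) : (0 < p)%N -> ~ (forall k, (0 < k)%N -> X (k + p)%N <= C * X k).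
  move=> p0 H.
  pose m := (Num.bound `|C|).+1.
  have Cm : C < m%:R.
    apply: le_lt_trans (ler_norm C) _; apply: lt_trans (archi_boundP (normr_ge0 C)) _.
    by rewrite ltr_nat.
  have [k0 Hk0] := Xgrow m.
  have mono k : (k0 <= k)%N -> X k <= X k.+1.
    move=> /Hk0; apply: le_trans; rewrite ler_peMl ?(ltW (X0 _))//.
    by rewrite -[1]/(1%:R) ler_nat.
  have monop q k : (k0 <= k)%N -> X k <= X (k + q)%N.
    move=> kk0; elim: q => [|q IH]; first by rewrite addn0.
    by rewrite addnS; apply: le_trans IH (mono _ (leq_trans kk0 (leq_addr _ _))).
  have kk : (k0 <= k0.+1)%N by [].
  have h1 := H k0.+1 isT; have h2 := Hk0 _ kk.
  have h3 := monop p.-1 k0.+2 (leqW kk).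
  rewrite addSnnS prednK// in h3.
  have : C * X k0.+1 < m%:R * X k0.+1 by rewrite ltr_pM2r// X0.
  lra.
have chain1 y : U y -> exists K, [/\ connected K, K `<=` U, K z, K y & comparable_orders f K].
  move=> Uy; apply: (connected_by_local_property cU _ (@comparable_ordersU R f) Uz Uy) => x Ux.
  have [rho rho0 [HF HB]] := comparable_orders_local hf (UF _ Ux).
  by exists rho => //; split => //; exact: discU.
have X1 k : 1 <= X k.
  by rewrite -[leLHS]expRK ler_ln ?posrE ?expR_gt0//; [have [] := Nbig k|have := R3 k; lra].
have log_orbit_z k : log_orbit f k z <= X k.
  apply: log_orbit_le; first exact: X1.
  have [->|z0] := eqVneq (cmod (iter k f z)) 0; first by rewrite ln0//; have := X0 k; lra.
  have z0' : 0 < cmod (iter k f z) by rewrite lt_neqAle eq_sym z0 cmod_ge0.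
  by rewrite ler_ln ?posrE ?up//; have := R3 k; lra.
have [K1 [cK1 K1U K1z K1z1 [c c1 Hc]]] := chain1 z1 Uz1.
have Xlg k : (0 < k)%N -> X k <= c * log_orbit f k z.
  move=> k0; have [y K1y Hy] := G K1 z z1 cK1 K1z K1z1 zN z1N k.
  apply: le_trans (Hc k y z k0 K1y K1z); apply: le_trans (log_orbit_ge_ln f k y).
  by apply: le_trans Hy; rewrite -/(X k) ler_peMl ?(ltW (X0 k))// ltW.
have both y : U y -> exists2 d : R, 0 < d &
    forall k, (0 < k)%N -> X k <= d * log_orbit f k y /\ log_orbit f k y <= d * X k.
  move=> Uy; have [K [cK KU Kz Ky [d d1 Hd]]] := chain1 y Uy.
  have c0 : 0 < c by lra.
  have d0 : 0 < d by lra.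
  exists (c * d); first exact: mulr_gt0.
  move=> k k0; split.
    by apply: le_trans (Xlg k k0) _; rewrite -mulrA ler_pM2l//; exact: Hd.
  apply: le_trans (Hd k y z k0 Ky Kz) _.
  apply: (@le_trans _ _ (d * X k)); first by rewrite ler_pM2l.
  by rewrite ler_pM2r ?X0// ler_peMl// ltW.
have Xoo (B : R) : exists n0, forall k, (n0 <= k)%N -> B <= X k.
  have /cvgryPge/(_ (expR B))[n0 _ Hn0] := hRoo.
  exists n0 => k kn; rewrite -[leLHS]expRK ler_ln ?posrE ?expR_gt0//.
    by apply: Hn0; exact: leq_trans kn (leq_addl _ _).
  by have := R3 k; lra.
have lnoo y (B : R) : U y -> exists n0, forall k, (n0 <= k)%N -> B <= ln (cmod (iter k f y)).
  move=> Uy; have [d d0 Hd] := both y Uy.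
  have [n0 Hn0] := Xoo (d * Num.max (B + 1) 2).
  exists n0.+1 => k kn; have k0 : (0 < k)%N by exact: leq_ltn_trans kn.
  have := le_trans (Hn0 k (ltnW kn)) (Hd k k0).1; rewrite ler_pM2l// /log_orbit.
  rewrite ge_max !le_max => /andP[/orP[h1|h1] /orP[h2|h2]]; lra.
(* Otherwise U meets the circle through f^n(x), hence contains some d together
   with f^n(d), which [X_shift_unbounded] forbids. *)
have omit x rho : U x -> 0 < rho -> (forall w, cmod (w - x) < rho -> Fatou f w) ->
    exists n0, forall n, (n0 <= n)%N -> exists2 w0 : Cplx R, cmod w0 = cmod (iter n f x) &
      forall w, cmod (w - x) < rho -> iter n f w != w0.
  move=> Ux rho0 HF; have [n0 Hn0] := lnoo x (Num.max 1 (ln (cmod z + 1))) Ux.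
  exists n0.+1 => n nn0; have n00 : (0 < n)%N by exact: leq_ltn_trans nn0.
  apply: contrapT => Hno.
  have := Hn0 n (ltnW nn0); rewrite ge_max => /andP[l1 l2].
  have s0 : 0 < cmod (iter n f x).
    rewrite lt_neqAle cmod_ge0 andbT eq_sym; apply/negP => /eqP E.
    by move: l1; rewrite E (ln0 (lexx 0)); lra.
  have cz1 : 0 < cmod z + 1 by rewrite ltr_wpDl ?cmod_ge0.
  have zs : cmod z <= cmod (iter n f x).
    by move: l2; rewrite ler_ln ?posrE//; lra.
  have [v Uv /ltW vs] := unb (cmod (iter n f x)).
  have [|u Uu us] := connected_IVT cU (fun w _ => @cmod_cont R w) Uz Uv (t := cmod (iter n f x)).
    by rewrite zs.
  have [d [dx du]] : exists d : Cplx R, cmod (d - x) < rho /\ iter n f d = u.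
    apply: contrapT => Hd; apply: Hno; exists u => // w wx; apply/eqP => E.
    by apply: Hd; exists w.
  have Ud : U d by exact: (discU x rho Ux rho0 HF).
  have [d1 d10 Hd1] := both d Ud; have [d2 d20 Hd2] := both u Uu.
  apply: (X_shift_unbounded (d1 * d2) n n00) => k k0.
  have := (Hd1 (k + n)%N (ltn_addr _ k0)).1.
  have -> : log_orbit f (k + n) d = log_orbit f k u by rewrite /log_orbit iterD du.
  move=> /le_trans; apply; rewrite -mulrA ler_pM2l//; exact: (Hd2 k k0).2.
have chain2 y : U y -> exists K, [/\ connected K, K `<=` U, K z, K y & asymptotic_orders f K].
  move=> Uy; apply: (connected_by_local_property cU _ (@asymptotic_ordersU R f) Uz Uy) => x Ux.
  have [rho [A [rho0 HF HA]]] := Fatou_dichotomy hf (UF _ Ux).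
  exists (rho / 64); first by rewrite divr_gt0.
  split; first by apply: discU => // [|w wx]; [rewrite divr_gt0|apply: HF; lra].
  move=> e e0.
  (* chosen so that (1 + e1) / (1 - e1) = 1 + e *)
  pose e1 := e / (2 + e).
  have e10 : 0 < e1 by rewrite divr_gt0//; lra.
  have e1E : 1 + e1 = (1 + e) * (1 - e1) by rewrite /e1; field; lra.
  have e11 : e1 < 1 by rewrite /e1 ltr_pdivrMr; lra.
  have [Lam HLam] := log_modulus_of_circle_omitting e10.
  have [n1 Hn1] := omit x rho Ux rho0 HF.
  have [n2 Hn2] := lnoo x (Num.max Lam (Num.max ((1 - e1)^-1) (Num.max 1 (ln (Num.max 1 A) + 1)))) Ux.
  exists (maxn 1 (maxn n1 n2)) => n w v; rewrite !geq_max => /andP[n0 /andP[nn1 nn2]] /= wx vx.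
  have [w0 w0c w0om] := Hn1 n nn1.
  set lx := ln (cmod (iter n f x)).
  have [l1 l2 l3 l4] : [/\ Lam <= lx, (1 - e1)^-1 <= lx, 1 <= lx &
      ln (Num.max 1 A) + 1 <= lx].
    by have := Hn2 n nn2; rewrite !ge_max => /andP[? /andP[? /andP[]]].
  have xx : cmod (x - x) < rho by rewrite subrr cmod0.
  have [big|bdd] := HA n n0; last first.
    exfalso; have fxA := bdd x xx.
    have fx0 : 0 < cmod (iter n f x).
      rewrite lt_neqAle cmod_ge0 andbT eq_sym; apply/negP => /eqP E.
      by move: l3; rewrite /lx E (ln0 (lexx 0)); lra.
    have : lx <= ln (Num.max 1 A).
      by rewrite ler_ln ?posrE ?lt_max ?ltr01// le_max fxA orbT.
    lra.
  have near q : cmod (q - x) < rho / 64 -> `|ln (cmod (iter n f q)) - lx| <= e1 * lx.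
    move=> /ltW; apply: (HLam (iter n f) x rho w0) => // q' _; exact: hol_iter.
  have lwv q : cmod (q - x) < rho / 64 -> log_orbit f n q = ln (cmod (iter n f q)).
    move=> /near; rewrite ler_norml => /andP[h _]; apply/max_idPr.
    have : 1 <= (1 - e1) * lx by rewrite -ler_pdivrMl ?mulr1//; lra.
    lra.
  rewrite !lwv//; have := near w wx; have := near v vx.
  rewrite !ler_norml => /andP[h1 _] /andP[_ h2].
  apply: (@le_trans _ _ ((1 + e1) * lx)); first by lra.
  by rewrite e1E -mulrA ler_pM2l; lra.
have [K2 [cK2 K2U K2z K2z1 H2]] := chain2 z1 Uz1.
have e0 : 0 < (L - 1) / 2 by lra.
have [n0 Hn0] := H2 _ e0.
have [y K2y Hy] := G K2 z z1 cK2 K2z K2z1 zN z1N n0.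
have := Hn0 n0 y z (leqnn _) K2y K2z.
have := le_trans Hy (log_orbit_ge_ln f n0 y); rewrite -/(X n0) => h1 h2.
have : (1 + (L - 1) / 2) * log_orbit f n0 z <= (1 + (L - 1) / 2) * X n0.
  by rewrite ler_pM2l//; lra.
have : 0 < (L - 1) * X n0 by rewrite mulr_gt0//; lra.
lra.
Qed.
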